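(* Let $G$ be a compact semisimple Lie group with Lie algebra $\mathfrak{g}$, with $\mathfrak{g}$ endowed with the inner product given by minus its Killing form. Let $G\hookrightarrow P\to B$ be a principal $G$-bundle on $B$ with total space $P$, endowed with a connection $1$-form $\theta:TP\to\mathfrak{g}$. Let $C$ be any Cartan subalgebra of $\mathfrak{g}$ and let $C^{\perp}$ be its orthogonal complement in $\mathfrak{g}$. Then $\theta$ is fat if and only if $C^{\perp}$ is fat.
   Context: Let $\langle\cdot,\cdot\rangle$ denote minus the Killing form of $\mathfrak{g}$. The connection $\theta$ induces a decomposition $TP=\mathcal{H}\oplus\mathcal{V}$ into horizontal and vertical subbundles; let $\Omega(-,-):\mathcal{H}\times\mathcal{H}\to\mathfrak{g}$ denote the curvature of $\theta$. For $u\in\mathfrak{g}$ define $\Omega_u:\mathcal{H}\times\mathcal{H}\to\mathbb{R}$ by $\Omega_u(Y_1,Y_2)=\langle\Omega(Y_1,Y_2),u\rangle$. The element $u$ is called fat if $\Omega_u$ is non-degenerate (on the horizontal space at every point of $P$). A linear subspace $V\subseteq\mathfrak{g}$ is called fat if every non-zero element of $V$ is fat. The connection $\theta$ is called fat if $\mathfrak{g}$ is fat. Cartan subalgebras of $\mathfrak{g}$ are its maximal toral (maximal abelian) subalgebras. *)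

(* Defs.v *)
From HB Require Import structures.
From mathcomp Require Import all_boot all_order all_algebra.
From mathcomp Require Import all_classical all_reals all_analysis.
Set Implicit Arguments.
Unset Strict Implicit.
Unset Printing Implicit Defensive.
Import Order.TTheory GRing.Theory Num.Theory.
Import numFieldNormedType.Exports.
Local Open Scope classical_set_scope.
Local Open Scope ring_scope.

(* C^oo maps between open subsets of normed spaces (finite-dimensional in all
   uses below). *)

Fixpoint Ck_on (R : realType) (E F : normedModType R) (k : nat)
    (U : set E) (f : E -> F) : Prop :=
  if k is k'.+1 then
    (forall x, U x -> differentiable f x) /\
    (forall v : E, Ck_on k' U (fun x => 'D_v f x))
  else forall x, U x -> {for x, continuous f}.

Definition smooth_on (R : realType) (E F : normedModType R)
    (U : set E) (f : E -> F) : Prop := forall k, Ck_on k U f.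

(* A chart is a homeomorphism [cmap] from the open set [cdom] of M onto the
   open set [ccod] of the model space, with inverse [cinv]; both functions are
   total, and only their values on [cdom] and [ccod] are meaningful. *)

Record chart (R : realType) (M : topologicalType) (E : normedModType R) :=
  Chart { cdom : set M; ccod : set E; cmap : M -> E; cinv : E -> M }.

Record is_chart (R : realType) (M : topologicalType) (E : normedModType R)
    (c : chart M E) : Prop := IsChart {
  cdom_open : open (cdom c);
  ccod_open : open (ccod c);
  cmap_cod : forall x, cdom c x -> ccod c (cmap c x);
  cinv_dom : forall y, ccod c y -> cdom c (cinv c y);
  cmapK : forall x, cdom c x -> cinv c (cmap c x) = x;
  cinvK : forall y, ccod c y -> cmap c (cinv c y) = y;
  cmap_cont : forall x, cdom c x -> {for x, continuous (cmap c)};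
  cinv_cont : forall y, ccod c y -> {for y, continuous (cinv c)} }.

Record charted (R : realType) := Charted {
  ch_carrier :> topologicalType;
  ch_model : normedModType R;
  ch_atlas : set (chart ch_carrier ch_model) }.

Definition charted_id (R : realType) (E : normedModType R) : charted R :=
  @Charted R E E [set Chart setT setT id id].

Definition charted_prod (R : realType) (M N : charted R) : charted R :=
  @Charted R (M * N)%type (ch_model M * ch_model N)%type
    [set e | exists c d, [/\ ch_atlas c, ch_atlas d &
       e = Chart (cdom c `*` cdom d) (ccod c `*` ccod d)
             (fun x => (cmap c x.1, cmap d x.2))
             (fun y => (cinv c y.1, cinv d y.2))]].

(* smoothness on the open set W *)
Definition smooth_map_on (R : realType) (M N : charted R) (W : set M)
    (f : M -> N) : Prop :=
  (forall x, W x -> {for x, continuous f}) /\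
  (forall c d, @ch_atlas R M c -> @ch_atlas R N d ->
     smooth_on (ccod c `&` cinv c @^-1` (W `&` f @^-1` cdom d))
       (cmap d \o f \o cinv c)).

Definition smooth_map (R : realType) (M N : charted R) (f : M -> N) : Prop :=
  smooth_map_on setT f.

Definition smooth_fun (R : realType) (M : charted R) (f : M -> R) : Prop :=
  @smooth_map R M (charted_id R^o) f.

Definition finite_dim (R : realType) (E : lmodType R) : Prop :=
  exists (n : nat) (e : 'I_n -> E),
    forall v, exists a : 'I_n -> R, v = \sum_i a i *: e i.

Record is_manifold (R : realType) (M : charted R) : Prop := IsManifold {
  mfd_hausdorff : hausdorff_space M;
  mfd_countable : @second_countable M;
  mfd_finite_dim : finite_dim (ch_model M);
  mfd_chart : forall c, @ch_atlas R M c -> is_chart c;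
  mfd_cover : forall x : M, exists2 c, @ch_atlas R M c & cdom c x;
  mfd_compat : forall c d, @ch_atlas R M c -> @ch_atlas R M d ->
    smooth_on (ccod c `&` cinv c @^-1` cdom d) (cmap d \o cinv c) }.

Record manifold (R : realType) := Manifold {
  mfd_charted :> charted R;
  mfdP : is_manifold mfd_charted }.

(* Tangent vectors at p are the derivations at p of the algebra of smooth
   functions.  They are represented by functionals on all functions, of which
   only the values on smooth functions matter: equality of tangent vectors is
   [eq_tangent]. *)

Record tangent (R : realType) (M : charted R) (p : M)
    (v : (M -> R) -> R) : Prop := Tangent {
  tangent_linear : forall (a : R) (f h : M -> R),
    smooth_fun f -> smooth_fun h ->
    v (fun x => a * f x + h x) = a * v f + v h;
  tangent_leibniz : forall f h : M -> R, smooth_fun f -> smooth_fun h ->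
    v (fun x => f x * h x) = v f * h p + f p * v h }.

Definition eq_tangent (R : realType) (M : charted R)
    (v w : (M -> R) -> R) : Prop :=
  forall f : M -> R, smooth_fun f -> v f = w f.

Definition pushforward (R : realType) (M N : charted R) (F : M -> N)
    (v : (M -> R) -> R) : (N -> R) -> R := fun f => v (f \o F).

Definition field_at (R : realType) (M : charted R)
    (X : (M -> R) -> (M -> R)) (p : M) : (M -> R) -> R := fun f => X f p.

Record vector_field (R : realType) (M : charted R)
    (X : (M -> R) -> (M -> R)) : Prop := VectorField {
  field_tangent : forall p, tangent p (field_at X p);
  field_smooth : forall f : M -> R, smooth_fun f -> smooth_fun (X f) }.

Definition field_bracket (R : realType) (M : charted R)
    (X Y : (M -> R) -> (M -> R)) : (M -> R) -> (M -> R) :=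
  fun f p => X (Y f) p - Y (X f) p.

Record lie_group (R : realType) := LieGroup {
  lg_mfd :> manifold R;
  lg_one : lg_mfd;
  lg_mul : lg_mfd -> lg_mfd -> lg_mfd;
  lg_inv : lg_mfd -> lg_mfd;
  lg_mulA : associative lg_mul;
  lg_mul1 : left_id lg_one lg_mul;
  lg_mulV : left_inverse lg_one lg_inv lg_mul;
  lg_mul_smooth : @smooth_map R (charted_prod lg_mfd lg_mfd) lg_mfd
    (fun x => lg_mul x.1 x.2);
  lg_inv_smooth : @smooth_map R lg_mfd lg_mfd lg_inv }.

Definition left_invariant (R : realType) (G : lie_group R)
    (X : (G -> R) -> (G -> R)) : Prop :=
  forall (a : G) (f : G -> R), smooth_fun f ->
    forall b, X (fun x => f (lg_mul a x)) b = X f (lg_mul a b).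

(* The Lie algebra of G: a finite-dimensional vector space identified by
   [la_field] with the space of left-invariant vector fields on G, the bracket
   being the commutator of vector fields. *)
Record lie_algebra (R : realType) (G : lie_group R) := LieAlgebra {
  la_space :> vectType R;
  la_field : la_space -> (G -> R) -> (G -> R);
  la_bracket : la_space -> la_space -> la_space;
  la_field_vector : forall x, vector_field (la_field x);
  la_field_left : forall x, left_invariant (la_field x);
  la_field_linear : forall (a : R) (x y : la_space) (f : G -> R),
    smooth_fun f ->
    forall b, la_field (a *: x + y) f b = a * la_field x f b + la_field y f b;
  la_field_inj : forall x y : la_space,
    (forall f : G -> R, smooth_fun f -> la_field x f = la_field y f) -> x = y;
  la_field_surj : forall X, vector_field X -> left_invariant X ->
    exists x, forall f : G -> R, smooth_fun f -> la_field x f = X f;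
  la_bracketE : forall x y (f : G -> R), smooth_fun f ->
    la_field (la_bracket x y) f = field_bracket (la_field x) (la_field y) f }.

Section LieAlgebra.
Context (R : realType) (G : lie_group R) (g : lie_algebra G).

(* trace of ad x \o ad y, computed in a basis *)
Definition killing (x y : g) : R :=
  \sum_(i < \dim {:g})
    coord (vbasis {:g}) i (la_bracket x (la_bracket y (vbasis {:g})`_i)).

Definition inner (x y : g) : R := - killing x y.

Definition abelian_sub (V : {vspace g}) : Prop :=
  forall x y, x \in V -> y \in V -> la_bracket x y = 0.

Definition ideal_sub (V : {vspace g}) : Prop :=
  forall x y, y \in V -> la_bracket x y \in V.

(* no nonzero abelian ideal *)
Definition semisimple : Prop :=
  forall V : {vspace g}, ideal_sub V -> abelian_sub V -> V = 0%VS.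

(* maximal among the abelian subalgebras *)
Definition cartan_sub (C : {vspace g}) : Prop :=
  abelian_sub C /\
  forall D : {vspace g}, abelian_sub D -> (C <= D)%VS -> D = C.

Definition orth_compl (C : {vspace g}) : set g :=
  [set u | forall c, c \in C -> inner u c = 0].

(* the tangent vector at the identity defined by x *)
Definition la_tangent (x : g) : (G -> R) -> R := field_at (la_field x) (lg_one G).

(* the differential at the identity of b |-> a b a^-1 *)
Definition Ad (a : G) (x : g) : g :=
  xget 0 [set y | @eq_tangent R G (la_tangent y)
    (pushforward (fun b : G => lg_mul (lg_mul a b) (lg_inv a) : G)
       (la_tangent x))].

End LieAlgebra.

Record principal_bundle (R : realType) (G : lie_group R) := PrincipalBundle {
  pb_total : manifold R;
  pb_base : manifold R;
  pb_proj : pb_total -> pb_base;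
  pb_act : pb_total -> G -> pb_total;
  pb_proj_smooth : @smooth_map R pb_total pb_base pb_proj;
  pb_act_smooth : @smooth_map R (charted_prod pb_total G) pb_total
    (fun x => pb_act x.1 x.2);
  pb_act1 : forall p, pb_act p (lg_one G) = p;
  pb_actM : forall p a b, pb_act p (lg_mul a b) = pb_act (pb_act p a) b;
  pb_proj_act : forall p a, pb_proj (pb_act p a) = pb_proj p;
  (* over U, the map p |-> (pb_proj p, h p) is an equivariant diffeomorphism
     onto U * G, with inverse t *)
  pb_local_triv : forall b : pb_base,
    exists (U : set pb_base) (h : pb_total -> G)
           (t : (pb_base * G)%type -> pb_total),
      [/\ open U /\ U b,
          @smooth_map_on R pb_total G (pb_proj @^-1` U) h,
          @smooth_map_on R (charted_prod pb_base G) pb_total (U `*` setT) t,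
          (forall p, U (pb_proj p) -> t (pb_proj p, h p) = p) /\
          (forall x a, U x -> pb_proj (t (x, a)) = x /\ h (t (x, a)) = a) &
          forall p a, U (pb_proj p) -> h (pb_act p a) = lg_mul (h p) a] }.

(* value at p of the fundamental vector field of x on the total space, i.e.
   the derivative of t |-> p . exp (t x) at t = 0 *)
Definition fundamental (R : realType) (G : lie_group R) (g : lie_algebra G)
    (P : principal_bundle G) (x : g) (p : pb_total P) :
    (pb_total P -> R) -> R :=
  pushforward (fun a : G => pb_act p a : pb_total P) (la_tangent x).

(* A g-valued 1-form is smooth when its components on smooth vector fields, in
   a basis of g, are smooth functions. *)
Record connection (R : realType) (G : lie_group R) (g : lie_algebra G)
    (P : principal_bundle G) := Connection {
  cn_form :> forall p : pb_total P, ((pb_total P -> R) -> R) -> g;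
  cn_ext : forall (p : pb_total P) v w, tangent p v -> tangent p w ->
    @eq_tangent R (pb_total P) v w -> cn_form p v = cn_form p w;
  cn_linear : forall (p : pb_total P) (a : R) v w, tangent p v -> tangent p w ->
    cn_form p (fun f => a * v f + w f) = a *: cn_form p v + cn_form p w;
  cn_smooth : forall X, @vector_field R (pb_total P) X -> forall i,
    @smooth_fun R (pb_total P)
      (fun p => coord (vbasis {:g}) i (cn_form p (field_at X p)));
  cn_fundamental : forall (p : pb_total P) (x : g),
    cn_form p (fundamental x p) = x;
  cn_equivariant : forall (p : pb_total P) (a : G) v, tangent p v ->
    cn_form (pb_act p a)
      (pushforward (fun q : pb_total P => pb_act q a : pb_total P) v) =
    Ad (lg_inv a) (cn_form p v) }.

Section Curvature.
Context (R : realType) (G : lie_group R) (g : lie_algebra G).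
Context (P : principal_bundle G) (theta : connection g P).
Implicit Types X Y : (pb_total P -> R) -> (pb_total P -> R).

Definition horizontal (p : pb_total P) (v : (pb_total P -> R) -> R) : Prop :=
  tangent p v /\ theta p v = 0.

Definition cn_on X : pb_total P -> g := fun p => theta p (field_at X p).

(* derivative of a g-valued function along X *)
Definition field_vec X (F : pb_total P -> g) (p : pb_total P) : g :=
  \sum_(i < \dim {:g})
    X (fun q => coord (vbasis {:g}) i (F q)) p *: (vbasis {:g})`_i.

(* (d theta + 1/2 [theta, theta]) (X, Y) *)
Definition curvature X Y (p : pb_total P) : g :=
  field_vec X (cn_on Y) p - field_vec Y (cn_on X) p
    - cn_on (@field_bracket R (pb_total P) X Y) p
    + la_bracket (cn_on X p) (cn_on Y p).

Definition curvature_form (u : g) X Y (p : pb_total P) : R :=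
  inner (curvature X Y p) u.

(* Non-degeneracy of [curvature_form u] on the horizontal space at every p.
   Vectors at p are given as values at p of vector fields: every tangent
   vector is such a value, and the value of a 2-form at p depends only on the
   values at p of its arguments. *)
Definition fat_elt (u : g) : Prop :=
  forall (p : pb_total P) X, @vector_field R (pb_total P) X ->
    horizontal p (field_at X p) ->
    (forall Y, @vector_field R (pb_total P) Y -> horizontal p (field_at Y p) ->
       curvature_form u X Y p = 0) ->
    @eq_tangent R (pb_total P) (field_at X p) (fun=> 0).

Definition fat_sub (V : set g) : Prop :=
  forall u, V u -> u != 0 -> fat_elt u.

Definition fat_connection : Prop := fat_sub [set: g].

End Curvature.

(* Main.v *)
Require Import Defs.
From HB Require Import structures.
From mathcomp Require Import all_boot all_order all_algebra.
From mathcomp Require Import all_classical all_reals all_analysis.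
From mathcomp Require Import ring lra.
Set Implicit Arguments.
Unset Strict Implicit.
Unset Printing Implicit Defensive.
Import Order.TTheory GRing.Theory Num.Theory.
Import numFieldNormedType.Exports.
Local Open Scope classical_set_scope.
Local Open Scope ring_scope.

(** If the connection is fat, so is every subspace; the converse rests on two
    facts about the adjoint action of [G].

    - Fatness is invariant under [Ad] ([fat_elt_Ad]). Right translation by [a]
      moves horizontal fields to horizontal fields, and the curvature is
      equivariant, so that [Omega_u] at [p a] corresponds to [Omega_(Ad a u)]
      at [p].
    - Every adjoint orbit meets the orthogonal complement of an abelian
      subalgebra [C] ([Ad_orbit_meets_orth]). With a basis [c_i] of [C], take a
      point [y] of the compact orbit of [u] where the sum of the [<y, c_i>^2] is
      minimal, and let [h] be the sum of the [<y, c_i> c_i]. The first-order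
      condition says that [h] and [y] commute; the second-order condition then
      says that [ad h ad y] is nonnegative on the image of [ad h], hence
      everywhere, so its trace [- <h, y>] is nonnegative. But [<h, y>] is the
      minimum of the sum of squares, which therefore is zero.

    A nonzero [u] is therefore conjugate to a nonzero element of the complement
    of [C], which is fat, and so [u] is fat.

    The positivity of minus the Killing form comes from an invariant inner
    product ([compact_invariant_form]), obtained as the unique solution of a
    convex minimisation problem: [ad x] is skew for it, so that [<x, x>] is the
    squared norm of [ad x].

    Tangent vectors are derivations, so the calculus behind these arguments
    starts from Hadamard's lemma and bump functions, which identify derivations
    with directional derivatives in a chart ([tangent_chart]). On a product
    manifold, a derivative in one variable depends smoothly on the other one,
    which makes [Ad] smooth; and by the symmetry of second derivatives,
    derivations in different variables commute ([tangent_swap]), which makes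
    the bracket the derivative of [Ad] at the identity ([derive_Ad]). *)

(** * Differentiability classes in finite dimension *)

Section FiniteDimension.
Context (R : realType) (E : normedModType R).

(** Continuous linear coordinates for a spanning family: they reduce the
    calculus on a finite-dimensional normed space to real-valued functions. *)
Definition coords n (e : 'I_n -> E) (a : 'I_n -> {linear E -> R^o}) : Prop :=
  (forall i, continuous (a i)) /\ (forall v, v = \sum_i a i v *: e i).

(** On the unit sphere, which is compact, the norm of [\sum_i b_i e_i] has a
    positive minimum; its inverse bounds the coordinate functions. *)
Lemma independent_coords n (e : 'I_n -> E) :
  (forall v, exists a : 'I_n -> R, v = \sum_i a i *: e i) ->
  (forall b : 'I_n -> R, \sum_i b i *: e i = 0 -> forall i, b i = 0) ->
  exists a, coords e a.
Proof.
move=> /choice[c cE] indep.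
pose L (b : 'rV[R]_n) : E := \sum_i b 0 i *: e i.
have Lcont : continuous L.
  move=> b; rewrite /L.
  apply: (@cvg_big E 'I_n +%R 0 xpredT _ 'rV[R]_n (nbhs b) _
    (fun i (b : 'rV[R]_n) => b 0 i *: e i)) => [|i _].
    exact: add_continuous.
  apply: cvgZr_tmp.
  exact: coord_continuous.
have cL b i : c (L b) i = b 0 i.
  apply/eqP; rewrite -subr_eq0; apply/eqP; move: i; apply: indep.
  under eq_bigr do rewrite scalerBl.
  by rewrite sumrB -cE subrr.
have clin i : linear (fun v => c v i : R^o).
  move=> k u v /=; apply/eqP; rewrite -subr_eq0; apply/eqP.
  apply: (indep (fun i => c (k *: u + v) i - (k *: c u i + c v i))).
  under eq_bigr do rewrite scalerBl scalerDl -scalerA.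
  by rewrite sumrB big_split/= -scaler_sumr -!cE subrr.
have [m m0 mL] : exists2 m : R, 0 < m & forall b : 'rV[R]_n, m * `|b| <= `|L b|.
  pose S : set 'rV[R]_n := [set b | `|b| = 1].
  have LZ k b : L (k *: b) = k *: L b.
    by rewrite /L scaler_sumr; apply: eq_bigr => i _; rewrite mxE scalerA.
  have [[b0 Sb0]|S0] := pselect (S !=set0); last first.
    exists 1 => // b; suff -> : b = 0 by rewrite normr0 mulr0.
    apply/eqP/negPn/negP => b0; apply: S0; exists (`|b|^-1 *: b).
    by rewrite /S/= normrZ normfV normr_id mulVf// normr_eq0.
  have cS : compact S.
    apply: bounded_closed_compact.
      exists 1; split; first exact: num_real.
      by move=> x x1 b /= ->; rewrite ltW.
    apply: (@preimage_closed _ _ (fun b : 'rV[R]_n => `|b|) [set 1]).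
      by move=> b _; exact: norm_continuous.
    exact: closed_eq.
  have [c0 c0S cmin] : exists2 c0, c0 \in S &
      forall b, b \in S -> `|L c0| <= `|L b|.
    apply: EVT_min_rV => //; first by exists b0.
    apply: continuous_subspaceT => b; apply: continuous_comp; first exact: Lcont.
    exact: norm_continuous.
  exists `|L c0|.
    rewrite normr_gt0; apply/eqP => L0.
    have : `|c0| = 1 by move: c0S; rewrite inE.
    suff -> : c0 = 0 by rewrite normr0 => /esym/eqP; rewrite oner_eq0.
    by apply/rowP => i; rewrite mxE; exact: (indep (fun i => c0 0 i)).
  move=> b; have [->|b0'] := eqVneq b 0; first by rewrite normr0 mulr0.
  have := cmin (`|b|^-1 *: b).
  rewrite inE /S /mkset normrZ normfV normr_id mulVf ?normr_eq0// LZ.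
  rewrite normrZ normfV normr_id => /(_ erefl).
  by rewrite mulrC ler_pdivlMr ?normr_gt0.
pose a i : {linear E -> R^o} :=
  HB.pack (fun v => c v i : R^o) (GRing.isLinear.Build R E R^o _ _ (clin i)).
exists a; split=> [i|v]; last exact: cE.
apply: bounded_linear_continuous; apply/linear_boundedP.
near=> r => v /=.
have : m * `|\row_j c v j| <= `|v|.
  apply: le_trans (mL _) _.
  rewrite (_ : L _ = v)// /L.
  by under eq_bigr do rewrite mxE; rewrite -cE.
rewrite mulrC -ler_pdivlMr// => mv.
have : `|c v i| <= `|\row_j c v j|.
  rewrite [leRHS]/Num.norm /= mx_normrE.
  apply/bigmax_geP; right => /=; exists (0, i) => //=; by rewrite mxE.
move/le_trans => /(_ _ mv) /le_trans; apply.
rewrite mulrC ler_wpM2r//; near: r; apply: nbhs_pinfty_ge; exact: num_real.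
Unshelve. all: by end_near. Qed.

(** A dependent spanning family still spans without one of its members. *)
Lemma finite_dim_coords : finite_dim E ->
  exists n (e : 'I_n -> E) a, coords e a.
Proof.
case=> n; elim: n => [|n IH] [e eE].
  exists 0, e; apply: independent_coords => // b _; by case.
have [ind|dep] := pselect (forall b : 'I_n.+1 -> R,
    \sum_i b i *: e i = 0 -> forall i, b i = 0).
  by exists n.+1, e; exact: independent_coords.
move/existsNP : dep => [b /not_implyP[bE /existsNP[k /eqP bk]]].
apply: IH; exists (fun i => e (lift k i)) => v.
have ekE : e k = \sum_i - ((b k)^-1 * b (lift k i)) *: e (lift k i).
  under eq_bigr do rewrite scaleNr -scalerA.
  rewrite sumrN -scaler_sumr; apply/eqP; rewrite -subr_eq0 opprK.
  rewrite -(can_eq (scalerK bk)) scaler0 scalerDr scalerA divff// scale1r.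
  by move: bE; rewrite (bigD1_ord k)//= => ->.
have [c ->] := eE v.
exists (fun i => c (lift k i) - c k * ((b k)^-1 * b (lift k i))).
rewrite (bigD1_ord k)//= {1}ekE scaler_sumr -big_split/=.
by apply: eq_bigr => i _; rewrite scalerA -scalerDl mulrN addrC.
Qed.

End FiniteDimension.

Section DifferentiabilityClasses.
Context (R : realType).
Implicit Types E F : normedModType R.

Lemma Ck_on_sub E F k (U V : set E) (f : E -> F) :
  V `<=` U -> Ck_on k U f -> Ck_on k V f.
Proof.
elim: k f => [|k IH] f VU /=; first by move=> h x /VU; exact: h.
by move=> [df Df]; split=> [x /VU|v]; [exact: df|exact: IH].
Qed.

Lemma Ck_on_local E F k (U : set E) (f : E -> F) :
  (forall x, U x -> exists2 V : set E, V x & Ck_on k V f) -> Ck_on k U f.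
Proof.
elim: k f => [|k IH] f H /=.
  by move=> x /H[V Vx h]; exact: h.
split=> [x /H[V Vx [h _]]|v]; first exact: h.
by apply: IH => x /H[V Vx [_ h]]; exists V => //; exact: h.
Qed.

Lemma differentiable_ofP E F (f : E -> F) (df : {linear E -> F}) x :
  continuous df ->
  (forall e : R, 0 < e ->
     \forall h \near 0, `|f (h + x) - f x - df h| <= e * `|h|) ->
  differentiable f x /\ 'd f x = df :> (E -> F).
Proof.
move=> dfc H.
have E1 : f \o shift x = cst (f x) + df +o_ (0 : E) id.
  apply/eqaddoP => e e0; near=> h; rewrite /= !fctE /= opprD addrA.
  by near: h; exact: H.
have dE := diff_unique dfc E1; split=> //.
by apply/diff_locallyP; rewrite dE.
Unshelve. all: by end_near. Qed.

Lemma differentiable_bound E F (f : E -> F) x : differentiable f x ->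
  forall e : R, 0 < e ->
     \forall h \near 0, `|f (h + x) - f x - 'd f x h| <= e * `|h|.
Proof.
move=> /diff_locallyP[_ /eqaddoP H] e e0; near=> h.
have : `|(f \o shift x - (cst (f x) + 'd f x)) h| <= e * `|h|.
  by near: h; exact: H.
by rewrite /= !fctE /= opprD addrA.
Unshelve. all: by end_near. Qed.

Lemma near_eq_differentiable E F (f g : E -> F) x :
  {near x, f =1 g} -> differentiable f x -> differentiable g x.
Proof.
move=> fg df.
apply: (proj1 (differentiable_ofP (diff_continuous df) _)) => e e0.
have fgx : f x = g x by exact: (nbhs_singleton fg).
near=> h.
have -> : g (h + x) = f (h + x).
  apply/esym; near: h.
  have := fg; rewrite /= (near_shift 0 x)/=.
  by apply: filterS => h; rewrite subr0.
rewrite -fgx; near: h; exact: differentiable_bound.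
Unshelve. all: by end_near. Qed.

Lemma Ck_on_ext E F k (U : set E) (f g : E -> F) : open U ->
  (forall x, U x -> f x = g x) -> Ck_on k U f -> Ck_on k U g.
Proof.
move=> oU; elim: k f g => [|k IH] f g fg /=.
  move=> cf x Ux; have := cf _ Ux; rewrite /prop_for /continuous_at fg//.
  apply: cvg_trans; apply: near_eq_cvg.
  by near=> y; apply: fg; near: y; exact: open_nbhs_nbhs.
have nfg x : U x -> {near x, f =1 g}.
  by move=> Ux; near=> y; apply: fg; near: y; exact: open_nbhs_nbhs.
move=> [df Df]; split=> [x Ux|v].
  apply: near_eq_differentiable (df x Ux); exact: nfg.
by apply: IH (Df v) => x Ux; apply: near_eq_derive; exact: nfg.
Unshelve. all: by end_near. Qed.

Lemma Ck_onS E F k (U : set E) (f : E -> F) : Ck_on k.+1 U f -> Ck_on k U f.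
Proof.
elim: k f => [|k IH] f /= [df Df].
  by move=> x Ux; exact/differentiable_continuous/df.
by split=> // v; exact/IH/Df.
Qed.

Lemma Ck_on_cst E F k (U : set E) (c : F) : Ck_on k U (fun=> c).
Proof.
elim: k c => [|k IH] c /=; first by move=> x _; exact: cst_continuous.
split=> [x _|v]; first exact: differentiable_cst.
rewrite (_ : 'D_v _ = fun=> 0) //.
by apply/funext => x; rewrite derive_cst.
Qed.

Lemma Ck_on_linear E F k (U : set E) (f : {linear E -> F}) :
  continuous f -> Ck_on k U f.
Proof.
move=> cf; case: k => [|k] /=; first by move=> x _; exact: cf.
split=> [x _|v]; first exact: linear_differentiable.
rewrite (_ : 'D_v _ = fun=> f v); first exact: Ck_on_cst.
by apply/funext => x; rewrite deriveE ?diff_lin //; exact: linear_differentiable.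
Qed.

Lemma Ck_on_derive E F k (U : set E) (f : E -> F) v : Ck_on k.+1 U f ->
  Ck_on k U ('D_v f).
Proof. by case=> _; apply. Qed.

Lemma Ck_onD E F k (U : set E) (f g : E -> F) : open U ->
  Ck_on k U f -> Ck_on k U g -> Ck_on k U (fun x => f x + g x).
Proof.
move=> oU; elim: k f g => [|k IH] f g /=.
  by move=> cf cg x Ux; apply: continuousD; [exact: cf|exact: cg].
move=> [df Df] [dg Dg]; split=> [x Ux|v].
  by apply: differentiableD; [exact: df|exact: dg].
apply: Ck_on_ext (IH _ _ (Df v) (Dg v)) => // x Ux.
by rewrite deriveD //; apply: diff_derivable; [exact: df|exact: dg].
Qed.

Lemma Ck_onM E k (U : set E) (f g : E -> R^o) : open U ->
  Ck_on k U f -> Ck_on k U g -> Ck_on k U (fun x => f x * g x : R^o).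
Proof.
move=> oU; elim: k f g => [|k IH] f g.
  by move=> cf cg x Ux; apply: continuousM; [exact: cf|exact: cg].
move=> Cf Cg; have [df Df] := Cf; have [dg Dg] := Cg; split=> [x Ux|v].
  by apply: differentiableM; [exact: df|exact: dg].
apply: (@Ck_on_ext _ _ _ _ (fun x => f x * 'D_v g x + g x * 'D_v f x)) => //.
  move=> x Ux; rewrite deriveM //; apply: diff_derivable; [exact: df|exact: dg].
by apply: Ck_onD => //; apply: IH;
  first [exact: Ck_onS|exact: Ck_on_derive].
Qed.

Lemma Ck_onZr E F k (U : set E) (f : E -> R^o) (c : F) : open U ->
  Ck_on k U f -> Ck_on k U (fun x => f x *: c).
Proof.
move=> oU; elim: k f => [|k IH] f.
  by move=> cf x Ux; apply: cvgZr_tmp; exact: cf.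
move=> [df Df]; split=> [x Ux|v].
  by apply: differentiableZl; exact: df.
apply: Ck_on_ext (IH _ (Df v)) => // x Ux.
rewrite [RHS]deriveE; last by apply: differentiableZl; exact: df.
by rewrite diffZl /= ?deriveE //; exact: df.
Qed.

Lemma Ck_on_sum E F k (U : set E) (I : Type) (r : seq I) (P : pred I)
    (f : I -> E -> F) : open U ->
  (forall i, Ck_on k U (f i)) -> Ck_on k U (fun x => \sum_(i <- r | P i) f i x).
Proof.
move=> oU Cf; elim: r => [|i r IH].
  by under [X in Ck_on _ _ X]eq_fun do rewrite big_nil; exact: Ck_on_cst.
under [X in Ck_on _ _ X]eq_fun do rewrite big_cons.
by case: (P i) => //; apply: Ck_onD.
Qed.

(** A continuous linear map commutes with directional derivatives. *)
Lemma Ck_on_linear_comp E F (F' : normedModType R) k (U : set E)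
    (a : {linear F -> F'}) (f : E -> F) : open U -> continuous a ->
  Ck_on k U f -> Ck_on k U (a \o f).
Proof.
move=> oU ca; elim: k f => [|k IH] f.
  by move=> cf x Ux; apply: continuous_comp; [exact: cf|exact: ca].
move=> [df Df]; split=> [x Ux|v].
  by apply: differentiable_comp; [exact: df|exact: linear_differentiable].
apply: Ck_on_ext (IH _ (Df v)) => // x Ux.
have da y : differentiable a y by exact: linear_differentiable.
rewrite [RHS]deriveE; last by apply: differentiable_comp => //; exact: df.
rewrite diff_comp // ?diff_lin //=; last exact: df.
by rewrite deriveE //; exact: df.
Qed.

Lemma Ck_on_coords E F k (U : set E) n (e : 'I_n -> F) a (f : E -> F) :
  open U -> coords e a ->
  (forall i, Ck_on k U (a i \o f)) -> Ck_on k U f.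
Proof.
move=> oU [_ aE] Cf.
rewrite (_ : f = fun x => \sum_i a i (f x) *: e i).
  by apply: Ck_on_sum => // i; apply: Ck_onZr => //; exact: Cf.
by apply/funext => x; rewrite -aE.
Qed.

Lemma derive_coords E F (G : normedModType R) n (e : 'I_n -> F) a
    (f : F -> G) (x v : F) :
  coords e a -> differentiable f x ->
  'D_v f x = \sum_i a i v *: 'D_(e i) f x.
Proof.
move=> [_ aE] df; rewrite deriveE // {1}(aE v) linear_sum.
by apply: eq_bigr => i _; rewrite linearZ /= -deriveE.
Qed.

(** By the chain rule, a directional derivative of [f \o g] is a sum of products
    of a derivative of [g] with a derivative of [f] composed with [g], and the
    induction hypothesis applies to the latter. *)
Lemma Ck_on_comp_real E F k (U : set E) (V : set F) n (e : 'I_n -> F) a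
    (g : E -> F) (f : F -> R^o) : coords e a -> open U ->
  (forall x, U x -> V (g x)) ->
  Ck_on k U g -> Ck_on k V f -> Ck_on k U (f \o g).
Proof.
move=> ca oU UV; elim: k f => [|k IH] f Cg Cf.
  by move=> x Ux; apply: continuous_comp; [exact: Cg|exact/Cf/UV].
have [dg Dg] := Cg; have [df Df] := Cf; split=> [x Ux|v].
  by apply: differentiable_comp; [exact: dg|exact/df/UV].
apply: (@Ck_on_ext _ _ _ _
  (fun x => \sum_i a i ('D_v g x) * 'D_(e i) f (g x) : R^o)) => //.
  move=> x Ux; rewrite [RHS]deriveE; last first.
    by apply: differentiable_comp; [exact: dg|exact/df/UV].
  rewrite diff_comp /=; [|exact: dg|exact/df/UV].
  rewrite -!deriveE; [|exact: dg|exact/df/UV].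
  by rewrite (derive_coords _ _ ca)//; exact/df/UV.
apply: Ck_on_sum => // i; apply: Ck_onM => //.
  apply: (Ck_on_linear_comp (a := a i)) => //; first by case: ca.
  exact: Ck_on_derive.
apply: (IH ('D_(e i) f)); [exact: Ck_onS|exact: Ck_on_derive].
Qed.

Lemma Ck_on_comp E F (G : normedModType R) k (U : set E) (V : set F)
    (g : E -> F) (f : F -> G) : finite_dim F -> finite_dim G ->
  open U -> open V -> (forall x, U x -> V (g x)) ->
  Ck_on k U g -> Ck_on k V f -> Ck_on k U (f \o g).
Proof.
move=> /finite_dim_coords[n [e [a ca]]] /finite_dim_coords[m [e' [b cb]]].
move=> oU oV UV Cg Cf.
apply: (Ck_on_coords oU cb) => i.
apply: (Ck_on_comp_real (f := b i \o f) ca oU UV Cg).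
by apply: Ck_on_linear_comp => //; case: cb.
Qed.

Lemma Ck_on_pair E F (G : normedModType R) k (U : set E)
    (f : E -> F) (g : E -> G) : open U ->
  Ck_on k U f -> Ck_on k U g -> Ck_on k U (fun x => (f x, g x)).
Proof.
move=> oU; elim: k f g => [|k IH] f g.
  by move=> cf cg x Ux; apply: cvg_pair; [exact: cf|exact: cg].
move=> [df Df] [dg Dg]; split=> [x Ux|v].
  by apply: differentiable_pair; [exact: df|exact: dg].
apply: Ck_on_ext (IH _ _ (Df v) (Dg v)) => // x Ux.
rewrite [RHS]deriveE; last by apply: differentiable_pair; [exact: df|exact: dg].
by rewrite diff_pair ?deriveE //=; do ?[exact: df|exact: dg].
Qed.

Lemma is_derive_line E F (f : E -> F) a v (t : R) :
  derivable f (a + t *: v) v ->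
  is_derive t 1 (fun r : R => f (a + r *: v)) ('D_v f (a + t *: v)).
Proof.
have lineE : (fun h : R => h^-1 *: (f (a + (h *: 1 + t) *: v) - f (a + t *: v)))
    = (fun h => h^-1 *: (f (h *: v + (a + t *: v)) - f (a + t *: v))).
  apply/funext => h; do 3 f_equal.
  by rewrite [h *: 1]mulr1 scalerDl addrCA.
by move=> df; split; rewrite /derivable /derive /= lineE.
Qed.

Lemma MVT_line E (f : E -> R^o) a v (s : R) : 0 < s ->
  (forall t, 0 <= t <= s -> differentiable f (a + t *: v)) ->
  exists2 t : R, 0 < t < s &
    f (a + s *: v) - f a = s * 'D_v f (a + t *: v).
Proof.
move=> s0 df.
have dl t : 0 <= t <= s ->
    is_derive t 1 (fun r : R => f (a + r *: v)) ('D_v f (a + t *: v)).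
  by move=> ?; apply: is_derive_line; apply: diff_derivable; exact: df.
have [||t ts] := @MVT R (fun r => f (a + r *: v))
    (fun t => 'D_v f (a + t *: v)) 0 s s0.
- move=> t; rewrite in_itv/= => /andP[t0 ts]; apply: dl.
  by rewrite !ltW.
- apply: derivable_within_continuous => t; rewrite in_itv/= => tI.
  by have [] := dl t tI.
rewrite scale0r addr0 subr0 mulrC => ->; exists t => //.
Qed.

(** The mean value theorem twice: in the direction [v] for the difference of [f]
    along [w], then in the direction [w] for ['D_v f]. *)
Lemma second_difference E (U : set E) (f : E -> R^o) x v w (s : R) :
  Ck_on 2 U f -> 0 < s ->
  (forall p q : R, 0 <= p <= s -> 0 <= q <= s -> U (x + p *: v + q *: w)) ->
  exists p q : R, [/\ 0 < p < s, 0 < q < s &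
    f (x + s *: v + s *: w) - f (x + s *: v) - (f (x + s *: w) - f x)
      = s * (s * 'D_w ('D_v f) (x + p *: v + q *: w))].
Proof.
move=> [df /(_ v)[dDf _]] s0 HU.
have s1 : 0 <= s <= s by rewrite lexx ltW.
have s2 : (0 : R) <= 0 <= s by rewrite lexx ltW.
have HU0 p : 0 <= p <= s -> U (x + p *: v).
  by move=> /HU /(_ s2); rewrite scale0r addr0.
pose g y : R^o := f (y + s *: w) - f y.
have dg y : U (y + s *: w) -> U y ->
    is_derive y v g ('D_v f (y + s *: w) - 'D_v f y).
  move=> Uy1 Uy.
  have d1 : is_derive y v (fun y => f (y + s *: w)) ('D_v f (y + s *: w)).
    have e : (fun h : R => h^-1 *: (f (h *: v + y + s *: w) - f (y + s *: w)))
      = (fun h => h^-1 *: (f (h *: v + (y + s *: w)) - f (y + s *: w))).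
      by apply/funext => h; rewrite addrA.
    split; last by rewrite /derive /= e.
    rewrite /derivable /= e; exact/diff_derivable/df.
  apply: is_deriveB => //; apply/derivableP/diff_derivable/df => //.
have gE p : 0 <= p <= s -> is_derive (x + p *: v) v g
    ('D_v f (x + p *: v + s *: w) - 'D_v f (x + p *: v)).
  by move=> ps; apply: dg; [exact: HU|exact: HU0].
have dl t : 0 <= t <= s ->
    is_derive t 1 (fun r : R => g (x + r *: v)) ('D_v g (x + t *: v)).
  by move=> /gE[dgt _]; exact: is_derive_line.
have [||p ps gp] := @MVT R (fun r => g (x + r *: v))
    (fun t => 'D_v g (x + t *: v)) 0 s s0.
- move=> t; rewrite in_itv/= => /andP[t0 ts]; apply: dl.
  by rewrite !ltW.
- apply: derivable_within_continuous => t; rewrite in_itv/= => tI.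
  by have [] := dl t tI.
have {}ps : 0 < p < s by move: ps; rewrite in_itv.
have ps' : 0 <= p <= s by case/andP: ps => ? ?; rewrite !ltW.
have [|q qs qE] := @MVT_line _ ('D_v f) (x + p *: v) w s s0.
  by move=> t ts; apply: dDf; exact: HU.
exists p, q; split => //.
by rewrite -qE -[RHS]mulrC; case: (gE p ps') => _ <-; rewrite -[s in RHS]subr0 -gp
  /g scale0r addr0.
Qed.

Lemma dist_halves (a b c e : R) : `|a - c| <= e / 2 -> `|b - c| <= e / 2 ->
  `|a - b| <= e.
Proof.
move=> ac bc; rewrite (splitr e) -(subrK c a) -addrA.
by rewrite (le_trans (ler_normD _ _))// lerD// distrC.
Qed.

(** The second difference along [v] and [w] is symmetric, and by the mean value
    theorem it is a value of either mixed derivative near the base point. *)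
Lemma derive_swap E (U : set E) (f : E -> R^o) x v w :
  open U -> U x -> Ck_on 2 U f -> 'D_w ('D_v f) x = 'D_v ('D_w f) x.
Proof.
move=> oU Ux Cf.
have c1 : {for x, continuous ('D_w ('D_v f))}.
  by have [_ /(_ v)[_ /(_ w)]] := Cf; apply.
have c2 : {for x, continuous ('D_v ('D_w f))}.
  by have [_ /(_ w)[_ /(_ v)]] := Cf; apply.
apply/eqP; rewrite -subr_eq0 -normr_le0; apply/ler_addgt0Pl.
move=> e /= e0; rewrite addr0; move: e e0.
suff : forall e : R, 0 < e -> `|'D_w ('D_v f) x - 'D_v ('D_w f) x| <= e by [].
move=> e e0.
have e20 : 0 < e / 2 by rewrite divr_gt0.
have : \forall y \near x, [/\ U y,
    `|'D_w ('D_v f) x - 'D_w ('D_v f) y| <= e / 2 &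
    `|'D_v ('D_w f) x - 'D_v ('D_w f) y| <= e / 2].
  move/cvgrPdist_le : c1 => /(_ _ e20) n1.
  move/cvgrPdist_le : c2 => /(_ _ e20) n2.
  have n0 : \forall y \near nbhs x, U y by exact: open_nbhs_nbhs.
  by apply: filterS3 n0 n1 n2 => y h0 h1 h2; exact: And3 h0 h1 h2.
move=> /nbhs_ballP[d /= d0 dP].
pose M := `|v| + `|w| + 1.
have M0 : 0 < M by rewrite /M ltr_wpDl // addr_ge0.
pose s := d / 2 / M.
have s0 : 0 < s by rewrite !divr_gt0.
have inball p q u : 0 <= p <= s -> 0 <= q <= s -> u = x + p *: v + q *: w ->
    ball x d u.
  move=> /andP[p0 ps] /andP[q0 qs] ->.
  rewrite -ball_normE /ball_/= -addrA opprD addNKr normrN.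
  apply: le_lt_trans (ler_normD _ _) _.
  rewrite !normrZ (ger0_norm p0) (ger0_norm q0).
  apply: (@le_lt_trans _ _ (s * M)); last first.
    by rewrite /s divfK ?gt_eqF// ltr_pdivrMr// ltr_pMr// ltr1n.
  have h1 : p * `|v| <= s * `|v| by apply: ler_wpM2r.
  have h2 : q * `|w| <= s * `|w| by apply: ler_wpM2r.
  by rewrite /M !mulrDr mulr1 -[leLHS]addr0; apply: lerD (ltW s0); exact: lerD.
have [|p [q [ps qs E1]]] := @second_difference _ U f x v w s Cf s0.
  by move=> p q hp hq; have [] := dP _ (inball p q _ hp hq erefl).
have [|q' [p' [qs' ps' E2]]] := @second_difference _ U f x w v s Cf s0.
  move=> q' p' hq hp; rewrite addrAC.
  by have [] := dP _ (inball p' q' _ hp hq erefl).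
have key (A B b c a0 a1 : R) : a1 - b - (c - a0) = s * (s * A) ->
    a1 - c - (b - a0) = s * (s * B) -> A = B.
  move=> h1 h2; have s0' := lt0r_neq0 s0.
  by apply: (mulfI s0'); apply: (mulfI s0'); rewrite -h1 -h2; ring.
have E3 : 'D_w ('D_v f) (x + p *: v + q *: w)
        = 'D_v ('D_w f) (x + p' *: v + q' *: w).
  rewrite [X in _ = 'D_v _ X]addrAC.
  by apply: key E1 _; rewrite -E2 (addrAC x).
have wk r : 0 < r < s -> 0 <= r <= s by case/andP => ? ?; rewrite !ltW.
have [_ h1 _] := dP _ (inball p q _ (wk _ ps) (wk _ qs) erefl).
have [_ _ h2] := dP _ (inball p' q' _ (wk _ ps') (wk _ qs') erefl).
exact: (dist_halves h1 (eq_ind _ (fun z => `|_ - z| <= _) h2 _ (esym E3))).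
Unshelve. all: by end_near. Qed.

End DifferentiabilityClasses.

(** * Hadamard's lemma and bump functions *)

Section Mean.
Context (R : realType).
Implicit Types f g F : R -> R^o.

(** The average over the unit interval, used to integrate along segments. *)
Definition mean f : R^o := \int[@lebesgue_measure R]_(t in `[0, 1]) f t.

Let integ f : continuous f ->
  (@lebesgue_measure R).-integrable `[0, 1] (EFin \o f).
Proof.
move=> cf; apply: continuous_compact_integrable; first exact: segment_compact.
exact: continuous_subspaceT.
Qed.

Lemma mean_derive F f : continuous f ->
  (forall t : R, is_derive t 1 F (f t)) -> mean f = F 1 - F 0.
Proof.
move=> cf dF; rewrite /mean /Rintegral (@continuous_FTC2 _ _ F) //.
- exact: continuous_subspaceT.
- have cF : continuous F.
    move=> t; apply: differentiable_continuous.
    by apply/derivable1_diffP; have [] := dF t.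
  split.
  + by move=> t _; have [] := dF t.
  + exact/cvg_at_right_filter/cF.
  + exact/cvg_at_left_filter/cF.
- by move=> t _; rewrite derive1E; have [_ ->] := dF t.
Qed.

Lemma mean_cst c : mean (fun=> c) = c.
Proof.
have dF (t : R) : is_derive t 1 ((id : R -> R^o) * cst c) c.
  by apply: is_derive_eq; rewrite scaler0 add0r [_ *: _]mulr1.
rewrite (mean_derive _ dF); last by move=> t; exact: cst_continuous.
by rewrite !fctE /= mul1r mul0r subr0.
Qed.

Lemma mean_dist f g M : continuous f -> continuous g ->
  (forall t, 0 <= t <= 1 -> `|f t - g t| <= M) -> `|mean f - mean g| <= M.
Proof.
move=> cf cg fg.
have cfg : continuous (fun t => f t - g t).
  by move=> t; apply: continuousB; [exact: cf|exact: cg].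
rewrite /mean -RintegralB //; [|exact: integ|exact: integ].
apply: le_trans (le_normr_Rintegral _ _) _ => //; first exact: integ.
rewrite -[leRHS](mean_cst M); apply: le_Rintegral => //.
- apply: (integ (f := fun t => `|f t - g t|)) => t.
  by apply: cvg_norm; exact: cfg.
- by apply: (integ (f := fun=> M)) => t; exact: cst_continuous.
Qed.

Lemma meanD f g : continuous f -> continuous g ->
  mean (fun t => f t + g t) = mean f + mean g.
Proof. by move=> cf cg; rewrite /mean RintegralD //; exact: integ. Qed.

Lemma mean_sum n (c : 'I_n -> R) (f : 'I_n -> R -> R^o) :
  (forall i, continuous (f i)) ->
  mean (fun t => \sum_i c i * f i t) = \sum_i c i * mean (f i).
Proof.
move=> cf; elim: n c f cf => [|n IH] c f cf.
  by rewrite big_ord0; under [X in mean X]eq_fun do rewrite big_ord0; exact: mean_cst.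
rewrite big_ord_recl -IH //.
under [X in mean X]eq_fun do rewrite big_ord_recl.
rewrite meanD; first by congr (_ + _); rewrite /mean RintegralZl//; exact: integ.
  by move=> t; apply: continuousM; [exact: cst_continuous|exact: cf].
move=> t; apply: (@cvg_big _ _ _ _ _ (@add_continuous R^o)) => i _.
by apply: continuousM; [exact: cst_continuous|exact: cf].
Qed.

End Mean.

Section Hadamard.
Context (R : realType) (E : normedModType R) (n : nat) (e : 'I_n -> E).
Context (a : 'I_n -> {linear E -> R^o}) (ca : coords e a).
Implicit Types Phi : (R * E)%type -> R^o.

Let near_pair (t : R) (x : E) Phi : continuous Phi ->
  Phi (p.1, x + p.2) @[p --> (t, 0 : E)] --> Phi (t, x) /\
  Phi (p.1, x) @[p --> (t, 0 : E)] --> Phi (t, x).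
Proof.
move=> cPhi.
have h1 : (fun p : R * E => p.1) @ nbhs (t, 0 : E) --> nbhs t by exact: cvg_fst.
have h2 : (fun p : R * E => x + p.2) @ nbhs (t, 0 : E) --> nbhs x.
  by rewrite -[X in _ --> nbhs X]addr0; apply: cvgD; [exact: cvg_cst|exact: cvg_snd].
have h3 : (fun p : R * E => x) @ nbhs (t, 0 : E) --> nbhs x by exact: cvg_cst.
by split; [exact: (cvg_comp _ _ (cvg_pair h1 h2) (cPhi (t, x)))
  |exact: (cvg_comp _ _ (cvg_pair h1 h3) (cPhi (t, x)))].
Qed.

(** The tube lemma over the compact segment. *)
Lemma unif_continuous_segment Phi x : continuous Phi ->
  forall eps : R, 0 < eps -> \forall h \near (0 : E),
    forall t : R, 0 <= t <= 1 -> `|Phi (t, x + h) - Phi (t, x)| <= eps.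
Proof.
move=> cPhi eps eps0.
have /compact_near_coveringP K := @segment_compact R 0 1.
have near_segment (t : R) : \forall t' \near t & h \near nbhs (0 : E),
    `|Phi (t', x + h) - Phi (t', x)| <= eps.
  have [c1 c2] := near_pair t x cPhi.
  have FF : Filter (nbhs (t, 0 : E)) by exact: nbhs_filter.
  have := cvgB c1 c2; rewrite subrr => /(_ FF) /cvgrPdist_le /(_ _ eps0).
  by apply: filterS => -[t' h] /=; rewrite sub0r normrN.
have := K E (nbhs (0 : E)) (fun h t => `|Phi (t, x + h) - Phi (t, x)| <= eps).
move=> /(_ _) H; near=> h => t t01.
suff : `[0, 1]%classic `<=` (fun t => `|Phi (t, x + h) - Phi (t, x)| <= eps).
  by apply; rewrite /= in_itv.
near: h; apply: H => t' _; exact: (near_segment t').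
Unshelve. all: by end_near. Qed.

Lemma coords_lipschitz : exists2 C : R, 0 < C &
  forall h, \sum_i `|a i h| <= C * `|h|.
Proof.
have /choice[k kP] i : exists k : R, forall h, `|a i h| <= k * `|h|.
  by have [k _ kP] := linear_lipschitz (ca.1 i); exists k.
exists (\sum_i `|k i| + 1) => [|h].
  by rewrite ltr_wpDl // sumr_ge0.
rewrite mulrDl mul1r mulr_suml ler_wpDr // ler_sum // => i _.
by apply: le_trans (kP i h) _; rewrite ler_wpM2r // ler_norm.
Qed.

(** Differentiation under the integral sign: on the compact segment the
    difference quotients converge uniformly. *)
Lemma Ck_on_mean k Phi : Ck_on k setT Phi ->
  Ck_on k setT (fun x => mean (fun t => Phi (t, x))).
Proof.
have cPhix (Psi : R * E -> R^o) x : continuous Psi -> continuous (fun t => Psi (t, x)).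
  move=> cPsi t; apply: (cvg_comp (fun t => (t, x)) Psi); last exact: cPsi.
  exact: (@cvg_pair _ _ _ (nbhs t) (nbhs t) (nbhs x) _ _ _ id (cst x) cvg_id (cvg_cst _)).
elim: k Phi => [|k IH] Phi.
  move=> cPhi x _; apply/cvgrPdist_le => eps eps0.
  have cP : continuous Phi by move=> p; exact: cPhi.
  have := unif_continuous_segment x cP eps0.
  rewrite (near_shift x 0) /= => H; near=> y.
  rewrite distrC; apply: mean_dist; [exact: cPhix|exact: cPhix|].
  near: y; apply: filterS H => y /= {}H t t01.
  by have := H t t01; rewrite sub0r addrCA subrr addr0.
move=> CPhi; have dPhi q : differentiable Phi q by exact: CPhi.1.
have cP : continuous Phi by move=> q; exact: differentiable_continuous.
pose D i := 'D_(0, e i) Phi.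
have cD i : continuous (D i).
  move=> q; have : Ck_on 0 setT (D i).
    by apply: (@Ck_on_sub _ _ _ _ setT) => //; case: {+}k (CPhi.2 (0, e i)) => //= k' [dD _] p _;
      apply: differentiable_continuous; exact: dD.
  exact.
pose c x i := mean (fun t => D i (t, x)).
have clin x : linear (fun h => \sum_i a i h * c x i : R^o).
  move=> r u v; rewrite scaler_sumr -big_split; apply: eq_bigr => i _ /=.
  by rewrite linearP mulrDl -scalerAl.
pose dJ x : {linear E -> R^o} := HB.pack (fun h => \sum_i a i h * c x i : R^o)
  (GRing.isLinear.Build R E R^o _ _ (clin x)).
have cdJ x : continuous (dJ x).
  move=> h; apply: (@cvg_big _ _ _ _ _ (@add_continuous R^o)) => i _.
  by apply: cvgM; [exact: ca.1|exact: cvg_cst].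
have DPhi (t : R) x h : 'D_(0, h) Phi (t, x) = \sum_i a i h * D i (t, x).
  rewrite /D deriveE //.
  have -> : (0 : R, h) = \sum_i a i h *: (0 : R, e i).
    rewrite {1}(ca.2 h); elim: (index_enum _) => [|i r IHr].
      by rewrite !big_nil.
    rewrite !big_cons -IHr; apply: injective_projections => //=.
    by rewrite scaler0 addr0.
  by rewrite linear_sum; apply: eq_bigr => i _; rewrite linearZ /= deriveE.
have dE x : differentiable (fun x => mean (fun t => Phi (t, x)) : R^o) x /\
    'd (fun x => mean (fun t => Phi (t, x)) : R^o) x = dJ x :> (E -> R^o).
  apply: differentiable_ofP => [|eps eps0]; first exact: cdJ.
  have [C C0 CP] := coords_lipschitz.
  have H : \forall h \near (0 : E), forall i : 'I_n, forall t : R, 0 <= t <= 1 ->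
      `|D i (t, x + h) - D i (t, x)| <= eps / C.
    apply: filter_forall => i.
    by apply: unif_continuous_segment => //; rewrite divr_gt0.
  move/nbhs_ballP : H => [d /= d0 dP].
  apply/nbhs_ballP; exists d => //= h hd.
  rewrite -mean_sum; last by move=> i; exact: cPhix.
  rewrite -addrA -opprD -meanD; last 2 first.
  - exact: cPhix.
  - move=> t; apply: (@cvg_big _ _ _ _ _ (@add_continuous R^o)) => i _.
    by apply: cvgM; [exact: cvg_cst|exact: cPhix].
  apply: mean_dist => [||t t01]; first exact: cPhix.
    move=> t; apply: cvgD; first exact: cPhix.
    apply: (@cvg_big _ _ _ _ _ (@add_continuous R^o)) => i _.
    by apply: cvgM; [exact: cvg_cst|exact: cPhix].
  have [//|th /andP[th0 th1]] := @MVT_line _ _ Phi (t, x) (0, h) 1 ltr01.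
  have tE (r : R) : (t, x) + r *: (0, h) = (t, x + r *: h).
    by apply: injective_projections => //=; rewrite scaler0 addr0.
  rewrite !tE scale1r mul1r DPhi opprD addrA [h + x]addrC => ->.
  rewrite -sumrB; under eq_bigr do rewrite -mulrBr.
  apply: le_trans (ler_norm_sum _ _ _) _.
  apply: (@le_trans _ _ (\sum_i `|a i h| * (eps / C))).
    apply: ler_sum => i _; rewrite normrM ler_wpM2l // dP //.
    move: hd; rewrite -!ball_normE /= !sub0r !normrN normrZ gtr0_norm //.
    by apply: le_lt_trans; rewrite ler_piMl // ltW.
  rewrite -mulr_suml mulrA ler_pdivrMr // mulrC mulrAC -mulrA ler_pM2l //.
split=> [x _|v]; first by have [] := dE x.
rewrite (_ : 'D_v _ = fun x => mean (fun t => 'D_(0, v) Phi (t, x))).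
  by apply: (IH ('D_(0, v) Phi)); exact: Ck_on_derive.
apply/funext => x; have [dx dxE] := dE x.
rewrite deriveE // dxE /= -mean_sum; last by move=> i; exact: cPhix.
by congr mean; apply/funext => t; rewrite DPhi.
Unshelve. all: by end_near. Qed.

(** Integrate the derivative of [F] along the segment from [x0] to [x]. *)
Lemma hadamard (F : E -> R^o) x0 : smooth_on setT F ->
  exists g : 'I_n -> E -> R^o, [/\ forall i, smooth_on setT (g i),
    forall i, g i x0 = 'D_(e i) F x0 &
    forall x, F x = F x0 + \sum_i a i (x - x0) * g i x].
Proof.
move=> sF; pose s (q : R * E) : E := x0 + q.1 *: (q.2 - x0).
have ss k : Ck_on k setT s.
  apply: (Ck_on_coords openT ca) => i.
  have -> : a i \o s = fun q => a i x0 + q.1 * (a i q.2 + a i (- x0)) :> R^o.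
    by apply/funext => q /=; rewrite /s linearD linearZ /= linearD.
  have c1 : continuous (fst : {linear (R * E)%type -> R}).
    by move=> q; exact: cvg_fst.
  have c2 : continuous (snd : {linear (R * E)%type -> E}).
    by move=> q; exact: cvg_snd.
  have o := @openT (R * E)%type.
  apply: Ck_onD => //; first exact: Ck_on_cst.
  apply: Ck_onM => //; first exact: Ck_on_linear c1.
  apply: Ck_onD => //; last exact: Ck_on_cst.
  apply: (Ck_on_linear_comp (a := a i) o (ca.1 i)); exact: Ck_on_linear c2.
pose Phi i (q : R * E) : R^o := 'D_(e i) F (s q).
have sPhi i k : Ck_on k setT (Phi i).
  apply: (@Ck_on_comp_real _ _ _ k setT setT _ _ _ s ('D_(e i) F) ca openT) => //.
  by apply: Ck_on_derive; exact: sF.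
exists (fun i x => mean (fun t => Phi i (t, x))); split.
- by move=> i k; exact: Ck_on_mean.
- move=> i; rewrite -[RHS]mean_cst; congr mean; apply/funext => t.
  by rewrite /Phi /s /= subrr scaler0 addr0.
- move=> x; have dF y : differentiable F y by have [d _] := sF 1; exact: d.
  have cPhi i : continuous (fun t : R => Phi i (t, x)).
    move=> t; apply: (cvg_comp (fun t => (t, x)) (Phi i)).
      exact: (@cvg_pair _ _ _ (nbhs t) (nbhs t) (nbhs x) _ _ _ id (cst x)
        cvg_id (cvg_cst _)).
    by have := sPhi i 0; exact.
  rewrite -mean_sum //.
  have dl (t : R) : is_derive t 1 (fun t : R => F (x0 + t *: (x - x0)) : R^o)
      (\sum_i a i (x - x0) * Phi i (t, x)).
    rewrite -(derive_coords _ _ ca) //.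
    by apply: is_derive_line; exact: diff_derivable.
  rewrite (mean_derive _ dl).
    by rewrite scale0r addr0 scale1r [x0 + _]addrC subrK [F x0 + _]addrC subrK.
  move=> t; apply: (@cvg_big _ _ _ _ _ (@add_continuous R^o)) => i _.
  by apply: cvgM; [exact: cvg_cst|exact: cPhi].
Qed.

End Hadamard.

Section FlatFunction.
Context (R : realType).

(** The smooth function [exp(-1/t)], extended by zero to nonpositive [t], with a
    factor [p(1/t)] that makes the family stable under differentiation: the
    derivative only changes the polynomial. *)
Definition flat (p : {poly R}) (t : R) : R^o :=
  if 0 < t then p.[t^-1] * expR (- t^-1) else 0.

Lemma expR_ge_pow n (s : R) : 0 <= s -> s ^+ n <= n`!%:R * expR s.
Proof.
case: n => [|n] s0.
  by rewrite expr0 fact0 mul1r -expR0 ler_expR.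
rewrite -ler_pdivrMl ?ltr0n ?fact_gt0 // mulrC.
by apply: le_trans (expR_ge1Dxn n s0); rewrite ler_wpDl.
Qed.

Lemma flat_le0 p t : t <= 0 -> flat p t = 0.
Proof. by rewrite /flat ltNge => ->. Qed.

(** [exp(-1/t)] beats every power of [t] at [0], and a quadratic bound is enough
    for a zero derivative there. *)
Lemma flat_bound p : exists C, forall t, `|t| < 1 -> `|flat p t| <= C * t ^+ 2.
Proof.
pose A := \sum_(i < size p) `|p`_i|.
exists (A * (size p + 2)`!%:R) => t t1.
have A0 : 0 <= A by rewrite sumr_ge0.
rewrite /flat; case: ifPn => [t0|_]; last first.
  by rewrite normr0 mulr_ge0 ?sqr_ge0 // mulr_ge0.
have s1 : 1 <= t^-1.
  by rewrite invf_ge1 // ltW //; move: t1; rewrite gtr0_norm.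
have s0 : 0 <= t^-1 by rewrite ltW // invr_gt0.
have pA : `|p.[t^-1]| <= A * t^-1 ^+ size p.
  rewrite horner_coef mulr_suml; apply: le_trans (ler_norm_sum _ _ _) _.
  apply: ler_sum => i _; rewrite normrM ler_wpM2l // normrX ger0_norm //.
  by apply: ler_weXn2l => //; rewrite ltnW.
rewrite normrM (ger0_norm (expR_ge0 _)) expRN -ler_pdivlMr ?invr_gt0 ?expR_gt0 //.
rewrite invrK; apply: le_trans pA _; rewrite -!mulrA ler_wpM2l //.
rewrite -(ler_pM2r (_ : 0 < t^-1 ^+ 2)) ?exprn_gt0 ?invr_gt0 // -exprD.
apply: le_trans (expR_ge_pow _ s0) _.
rewrite le_eqVlt; apply/orP; left; apply/eqP; field.
by rewrite gt_eqF.
Qed.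

Lemma is_derive_flat p t :
  is_derive (t : R) 1 (flat p) (flat ('X^2 * (p - p^`())) t).
Proof.
have [t0|t0|->] := ltgtP t 0.
- rewrite flat_le0 ?ltW //.
  have dc : is_derive t 1 (cst 0 : R -> R^o) 0 by exact: is_derive_cst.
  apply: near_eq_is_derive dc.
  by near=> x; rewrite flat_le0 // ltW //; near: x; exact: lt_nbhsl.
- have tn0 : t != 0 by rewrite gt_eqF.
  apply: (@near_eq_is_derive _ _ _
      ((horner p \o GRing.inv) * (expR \o (-%R \o GRing.inv)))).
    near=> x; rewrite /flat; case: ifPn => // /negP; case; near: x.
    exact: lt_nbhsr.
  have dV : is_derive t 1 (@GRing.inv R) (- t ^- 2).
    by apply: is_derive_eq; [apply: is_deriveV => //|rewrite [_ *: _]mulr1].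
  have d1 : is_derive t 1 (horner p \o GRing.inv) (p^`().[t^-1] * - t ^- 2).
    exact: is_derive1_comp.
  have dN : is_derive t 1 (-%R \o @GRing.inv R) (t ^- 2).
    by have := is_deriveN dV; rewrite opprK.
  have d2 : is_derive t 1 (expR \o (-%R \o GRing.inv)) (expR (- t^-1) * t ^- 2).
    exact: is_derive1_comp.
  apply: is_derive_eq; rewrite /flat t0 hornerM hornerXn hornerD hornerN /=.
  rewrite -[LHS]/(p.[t^-1] * (expR (- t^-1) * t ^- 2) +
    expR (- t^-1) * (p^`().[t^-1] * - t ^- 2)) -exprVn; ring.
- rewrite flat_le0 //.
  have [C CP] := flat_bound p.
  have cn : continuous (\0 : {linear R -> R^o}) by move=> x; exact: cst_continuous.
  have [|df dE] := @differentiable_ofP R R R^o (flat p) \0 0 cn; last first.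
    split; first exact: diff_derivable.
    by rewrite deriveE // dE.
  move=> eps eps0; near=> h; rewrite addr0 (flat_le0 p (lexx 0)) !subr0.
  have h1 : `|h| < 1.
    near: h; apply/nbhs_ballP; exists 1 => //= h.
    by rewrite /ball /= sub0r normrN.
  apply: le_trans (CP _ h1) _; rewrite -real_normK ?num_real // expr2 mulrA.
  apply: ler_wpM2r => //; apply: le_trans (ler_wpM2r _ (ler_norm C)) _ => //.
  have C1 : 0 < `|C| + 1 by rewrite ltr_wpDl.
  apply: (@le_trans _ _ ((`|C| + 1) * `|h|)); first by rewrite ler_wpM2r // lerDl.
  rewrite mulrC -ler_pdivlMr //.
  near: h; apply/nbhs_ballP; exists (eps / (`|C| + 1)); first exact: divr_gt0.
  by move=> h; rewrite /ball /= sub0r normrN => /ltW.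
Unshelve. all: by end_near. Qed.

Lemma smooth_flat p : smooth_on setT (flat p).
Proof.
move=> k; elim: k p => [|k IH] p.
  move=> t _; apply/differentiable_continuous/derivable1_diffP.
  by have [] := is_derive_flat p t.
have df t : differentiable (flat p) t.
  by apply/derivable1_diffP; have [] := is_derive_flat p t.
split=> // v.
rewrite (_ : 'D_v (flat p) = fun t => v * flat ('X^2 * (p - p^`())) t).
  by apply: Ck_onM (@openT R) _ (IH _); exact: Ck_on_cst.
apply/funext => t; rewrite deriveE // -[v in LHS]mulr1 -[v * 1]/(v *: 1).
rewrite linearZ /= -deriveE //; congr (_ * _).
by have [] := is_derive_flat p t.
Qed.

Lemma flat_gt0 t : 0 < t -> 0 < flat 1 t.
Proof. by move=> t0; rewrite /flat t0 hornerC mul1r expR_gt0. Qed.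

End FlatFunction.

Section Bump.
Context (R : realType) (E : normedModType R) (n : nat) (e : 'I_n -> E).
Context (a : 'I_n -> {linear E -> R^o}) (ca : coords e a).

(** Apply [exp(-1/t)] to [r^2 - q x], with [q x] the sum of the squares of the
    coordinates of [x - x0], and normalise. *)
Lemma smooth_bump (U : set E) x0 : open U -> U x0 ->
  exists (rho : E -> R^o) (K : set E),
    [/\ smooth_on setT rho, rho x0 = 1, compact K, K `<=` U &
      forall x, ~ K x -> rho x = 0].
Proof.
move=> oU Ux0.
pose L (b : 'rV[R]_n) : E := x0 + \sum_i b 0 i *: e i.
have cL : continuous L.
  move=> b; apply: (@continuousD _ _ _ (cst x0)); first exact: cst_continuous.
  apply: (@cvg_big E 'I_n +%R 0 xpredT _ 'rV[R]_n (nbhs b) _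
    (fun i (b : 'rV[R]_n) => b 0 i *: e i)) => [|i _].
    exact: add_continuous.
  by apply: cvgZr_tmp; exact: coord_continuous.
have L0 : L 0 = x0.
  by rewrite /L big1 ?addr0 // => i _; rewrite mxE scale0r.
have : \forall b \near nbhs (0 : 'rV[R]_n), U (L b).
  by apply: (cL 0 U); rewrite L0; exact: open_nbhs_nbhs.
move=> /nbhs_ballP[d /= d0 dU].
pose r := d / 2; have r0 : 0 < r by rewrite divr_gt0.
pose q x : R^o := \sum_i a i (x - x0) * a i (x - x0).
have sq k : Ck_on k setT q.
  have sa i : Ck_on k setT (fun x => a i (x - x0) : R^o).
    have -> : (fun x => a i (x - x0) : R^o) = (fun x => a i x + a i (- x0)).
      by apply/funext => x; rewrite linearD.
    apply: Ck_onD (@openT E) _ (Ck_on_cst _ _ _); exact: Ck_on_linear (ca.1 i).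
  by apply: Ck_on_sum (@openT E) _ => i; apply: Ck_onM (@openT E) _ _.
pose K : set E := [set x | q x <= r ^+ 2].
have cK x : K x -> exists2 b : 'rV[R]_n, `|b| <= r & L b = x.
  move=> Kx; exists (\row_i a i (x - x0)).
    rewrite [leLHS]/Num.norm /= mx_normrE; apply/bigmax_leP; split=> [|[i j] _ /=].
      exact: ltW.
    rewrite mxE -ler_sqr ?nnegrE //; last exact: ltW.
    rewrite real_normK ?num_real //.
    apply: le_trans Kx; rewrite /q (bigD1 j) //= -expr2 lerDl.
    by apply: sumr_ge0 => k _; rewrite -expr2 sqr_ge0.
  by rewrite /L; under eq_bigr do rewrite mxE; rewrite -(ca.2 (x - x0)) addrC subrK.
pose rho x : R^o := flat 1 (r ^+ 2 - q x) * (flat 1 (r ^+ 2))^-1.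
have r20 : 0 < r ^+ 2 by rewrite exprn_gt0.
exists rho, K; split.
- move=> k; apply: Ck_onM (@openT E) _ (Ck_on_cst _ _ _).
  apply: (Ck_on_comp (V := setT) (g := fun x => r ^+ 2 - q x)
    (f := flat 1)) => //; [| | exact: openT | exact: openT | | exact: smooth_flat].
  + by exists 1, (fun=> 1) => v; exists (fun=> v); rewrite big_ord1 [_ *: _]mulr1.
  + by exists 1, (fun=> 1) => v; exists (fun=> v); rewrite big_ord1 [_ *: _]mulr1.
  + apply: Ck_onD (@openT E) (Ck_on_cst _ _ _) _.
    have -> : (fun x => - q x) = (fun x => -1 * q x) :> (E -> R^o).
      by apply/funext => x; rewrite mulN1r.
    exact: Ck_onM (@openT E) (Ck_on_cst _ _ _) _.
- rewrite /rho /q big1 => [|i _]; last by rewrite subrr linear0 mulr0.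
  by rewrite subr0 mulfV // gt_eqF // flat_gt0.
- apply: (@subclosed_compact _ _ (L @` [set b | `|b| <= r])).
  + apply: (@preimage_closed _ _ q [set y | y <= r ^+ 2]).
      by move=> x _; have := sq 0; apply.
    exact: closed_le.
  + apply: continuous_compact; first exact: continuous_subspaceT.
    apply: bounded_closed_compact.
      exists r; split; first exact: num_real.
      by move=> s rs b /= br; rewrite (le_trans br) // ltW.
    apply: (@preimage_closed _ _ (fun b : 'rV[R]_n => `|b|) [set y | y <= r]).
      by move=> b _; exact: norm_continuous.
    exact: closed_le.
  + by move=> x /cK[b br <-]; exists b.
- move=> x /cK[b br <-]; apply: dU.
  rewrite -ball_normE /= sub0r normrN; apply: le_lt_trans br _.
  by rewrite /r ltr_pdivrMr // ltr_pMr // ltr1n.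
- move=> x /negP; rewrite /K /= -ltNge => qr; rewrite /rho flat_le0 ?mul0r //.
  by rewrite subr_le0 ltW.
Qed.

End Bump.

(** * Smooth maps *)

Section SmoothMaps.
Context (R : realType).
Implicit Types M N Q : charted R.

(** The conditions on the charts of a manifold, on which the local calculus of
    smooth maps rests; vector spaces and products of manifolds satisfy them too. *)
Record tame M : Prop := Tame {
  tame_fd : finite_dim (ch_model M);
  tame_chart : forall c, @ch_atlas R M c -> is_chart c;
  tame_cover : forall x : M, exists2 c, @ch_atlas R M c & cdom c x;
  tame_compat : forall c d, @ch_atlas R M c -> @ch_atlas R M d ->
    smooth_on (ccod c `&` cinv c @^-1` cdom d) (cmap d \o cinv c) }.

Lemma manifold_tame (M : manifold R) : tame M.
Proof. by case: (mfdP M) => *; split. Qed.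

Lemma finite_dim_R : finite_dim (R^o : normedModType R).
Proof.
by exists 1, (fun=> 1) => v; exists (fun=> v); rewrite big_ord1 [_ *: _]mulr1.
Qed.

Lemma tame_id (E : normedModType R) : finite_dim E -> tame (charted_id E).
Proof.
move=> fE; split=> //=.
- move=> c ->; split=> //=; try exact: openT.
  + by move=> x _; exact: cvg_id.
  + by move=> x _; exact: cvg_id.
- by move=> x; exists (Chart setT setT id id).
- move=> c d -> -> k /=.
  apply: (@Ck_on_linear _ _ _ k _ (idfun : {linear E -> E})) => x.
  exact: cvg_id.
Qed.

Lemma open_prod (T U : topologicalType) (A : set T) (B : set U) :
  open A -> open B -> open (A `*` B).
Proof.
move=> oA oB; rewrite openE => -[x y] /= [Ax By].
by exists (A, B) => //; split; exact: open_nbhs_nbhs.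
Qed.

Lemma chart_preimage_open (M : topologicalType) (E : normedModType R)
    (c : chart M E) (W : set M) : is_chart c -> open W ->
  open (ccod c `&` cinv c @^-1` W).
Proof.
move=> hc oW; rewrite openE => y [cy Wy].
apply: filterI; first by apply: open_nbhs_nbhs; split => //; exact: ccod_open.
by apply: (cinv_cont hc cy); exact: open_nbhs_nbhs.
Qed.

Lemma is_chart_prod (M N : topologicalType) (E F : normedModType R)
    (c : chart M E) (d : chart N F) : is_chart c -> is_chart d ->
  is_chart (Chart (cdom c `*` cdom d) (ccod c `*` ccod d)
             (fun x => (cmap c x.1, cmap d x.2))
             (fun y => (cinv c y.1, cinv d y.2))).
Proof.
move=> hc hd; split => /=.
- by apply: open_prod; exact: cdom_open.
- by apply: open_prod; exact: ccod_open.
- by move=> [x y] [/= cx dy]; split=> /=; exact: cmap_cod.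
- by move=> [x y] [/= cx dy]; split=> /=; exact: cinv_dom.
- by move=> [x y] [/= cx dy]; rewrite !cmapK.
- by move=> [x y] [/= cx dy]; rewrite !cinvK.
- move=> [x y] [/= cx dy]; apply: cvg_pair => /=.
    by apply: (cvg_comp _ (cmap c)); [exact: cvg_fst|exact: cmap_cont].
  by apply: (cvg_comp _ (cmap d)); [exact: cvg_snd|exact: cmap_cont].
- move=> [x y] [/= cx dy]; apply: cvg_pair => /=.
    by apply: (cvg_comp _ (cinv c)); [exact: cvg_fst|exact: cinv_cont].
  by apply: (cvg_comp _ (cinv d)); [exact: cvg_snd|exact: cinv_cont].
Qed.

Lemma finite_dim_prod (E F : normedModType R) :
  finite_dim E -> finite_dim F -> finite_dim (E * F)%type.
Proof.
move=> [n [e eE]] [m [f fF]].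
exists (n + m)%N, (fun i : 'I_(n + m) => match fintype.split i with inl j => (e j, 0) | inr j => (0, f j) end).
move=> [u v]; have [a ->] := eE u; have [b ->] := fF v.
exists (fun i : 'I_(n + m) => match fintype.split i with inl j => a j | inr j => b j end).
rewrite big_split_ord /=.
have lE : \sum_(i < n) a i *: (e i, 0 : F) = (\sum_i a i *: e i, 0).
  elim: (index_enum _) => [|i r IH]; first by rewrite !big_nil.
  rewrite !big_cons IH; apply: injective_projections => //=.
  by rewrite scaler0 addr0.
have rE : \sum_(i < m) b i *: (0 : E, f i) = (0, \sum_i b i *: f i).
  elim: (index_enum _) => [|i r IH]; first by rewrite !big_nil.
  rewrite !big_cons IH; apply: injective_projections => //=.
  by rewrite scaler0 addr0.
under [X in _ = X + _]eq_bigr => i _.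
  rewrite (unsplitK (inl i)); over.
under [X in _ = _ + X]eq_bigr => i _.
  rewrite (unsplitK (inr i)); over.
by rewrite lE rE; apply: injective_projections; rewrite /= ?addr0 ?add0r.
Qed.

Lemma Ck_on_fst (E F : normedModType R) k (U : set (E * F)%type) :
  Ck_on k U (fst : E * F -> E).
Proof.
by apply: (@Ck_on_linear _ _ _ k U (fst : {linear (E * F)%type -> E})) => q;
  exact: cvg_fst.
Qed.

Lemma Ck_on_snd (E F : normedModType R) k (U : set (E * F)%type) :
  Ck_on k U (snd : E * F -> F).
Proof.
by apply: (@Ck_on_linear _ _ _ k U (snd : {linear (E * F)%type -> F})) => q;
  exact: cvg_snd.
Qed.

Lemma Ck_on_comp_fst (E F G : normedModType R) k (U : set (E * F)%type)
    (V : set E) (f : E -> G) : finite_dim E -> finite_dim G -> open U -> open V ->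
  (forall q, U q -> V q.1) -> Ck_on k V f -> Ck_on k U (fun q => f q.1).
Proof.
move=> fE fG oU oV UV Cf.
exact: (Ck_on_comp fE fG oU oV UV (Ck_on_fst k U) Cf).
Qed.

Lemma Ck_on_comp_snd (E F G : normedModType R) k (U : set (E * F)%type)
    (V : set F) (f : F -> G) : finite_dim F -> finite_dim G -> open U -> open V ->
  (forall q, U q -> V q.2) -> Ck_on k V f -> Ck_on k U (fun q => f q.2).
Proof.
move=> fF fG oU oV UV Cf.
exact: (Ck_on_comp fF fG oU oV UV (Ck_on_snd k U) Cf).
Qed.

Lemma tame_prod M N : tame M -> tame N -> tame (charted_prod M N).
Proof.
move=> tM tN; split.
- exact: finite_dim_prod (tame_fd tM) (tame_fd tN).
- move=> e [c [d [hc hd ->]]].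
  exact: is_chart_prod (tame_chart tM hc) (tame_chart tN hd).
- move=> [x y]; have [c hc cx] := tame_cover tM x.
  have [d hd dy] := tame_cover tN y.
  by eexists; first by exists c, d; split.
- move=> e e' [c [d [hc hd ->]]] [c' [d' [hc' hd' ->]]] k /=.
  set U := (X in Ck_on k X _).
  have oU : open U.
    apply: (chart_preimage_open
      (is_chart_prod (tame_chart tM hc) (tame_chart tN hd))).
    by apply: open_prod; apply: cdom_open; [exact: (tame_chart tM)|exact: (tame_chart tN)].
  have oV := chart_preimage_open (tame_chart tM hc) (cdom_open (tame_chart tM hc')).
  have oV' := chart_preimage_open (tame_chart tN hd) (cdom_open (tame_chart tN hd')).
  apply: (@Ck_on_pair _ _ _ _ k U (fun q => (cmap c' \o cinv c) q.1)
    (fun q => (cmap d' \o cinv d) q.2)) => //.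
  + apply: (Ck_on_comp_fst (tame_fd tM) (tame_fd tM) oU oV _
      (tame_compat tM hc hc' k)).
    by move=> [y z] [[/= cy dz] [c'y d'z]].
  + apply: (Ck_on_comp_snd (tame_fd tN) (tame_fd tN) oU oV' _
      (tame_compat tN hd hd' k)).
    by move=> [y z] [[/= cy dz] [c'y d'z]].
Qed.

Lemma smooth_map_chart M N (f : M -> N) c d : smooth_map f ->
  @ch_atlas R M c -> @ch_atlas R N d ->
  smooth_on (ccod c `&` cinv c @^-1` (f @^-1` cdom d)) (cmap d \o f \o cinv c).
Proof. by move=> [_ sf] hc hd; have := sf c d hc hd; rewrite setTI. Qed.

Lemma smooth_map_continuous M N (f : M -> N) : smooth_map f -> continuous f.
Proof. by move=> [cf _] x; exact: cf. Qed.

Lemma smooth_mapP M N (f : M -> N) : continuous f ->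
  (forall c d, @ch_atlas R M c -> @ch_atlas R N d ->
  smooth_on (ccod c `&` cinv c @^-1` (f @^-1` cdom d)) (cmap d \o f \o cinv c)) ->
  smooth_map f.
Proof.
move=> cf sf; split=> [x _|c d hc hd]; first exact: cf.
by rewrite setTI; exact: sf.
Qed.

(** In coordinates the composite factors locally through a chart of the middle
    manifold, which reduces the claim to the chain rule. *)
Lemma smooth_map_comp M N Q (f : M -> N) (g : N -> Q) :
  tame M -> tame N -> tame Q -> smooth_map f -> smooth_map g ->
  smooth_map (g \o f).
Proof.
move=> tM tN tQ sf sg.
have cf := smooth_map_continuous sf; have cg := smooth_map_continuous sg.
apply: smooth_mapP => [x|c d hc hd k].
  exact: (cvg_comp f g (cf x) (cg _)).
apply: Ck_on_local => y [cy dy].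
have [e he ey] := tame_cover tN (f (cinv c y)).
have oW : open (f @^-1` (cdom e `&` g @^-1` cdom d)).
  apply: open_comp => [? _|]; first exact: cf.
  apply: openI; first exact: cdom_open (tame_chart tN he).
  by apply: open_comp => [? _|]; [exact: cg|exact: cdom_open (tame_chart tQ hd)].
pose V := ccod c `&` cinv c @^-1` (f @^-1` (cdom e `&` g @^-1` cdom d)).
have oV : open V := chart_preimage_open (tame_chart tM hc) oW.
exists V => //.
apply: (@Ck_on_ext _ _ _ _ V
  ((cmap d \o g \o cinv e) \o (cmap e \o f \o cinv c))) => //.
  by move=> z [_ [ez _]] /=; rewrite (cmapK (tame_chart tN he)).
apply: (@Ck_on_comp _ _ _ _ k V (ccod e `&` cinv e @^-1` (g @^-1` cdom d))
  (cmap e \o f \o cinv c) _ (tame_fd tN) (tame_fd tQ) oV).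
- apply: chart_preimage_open (tame_chart tN he) _.
  by apply: open_comp => [? _|]; [exact: cg|exact: cdom_open (tame_chart tQ hd)].
- move=> z [cz [ez dz]]; split; first exact: cmap_cod (tame_chart tN he) _ ez.
  by rewrite /= (cmapK (tame_chart tN he)).
- apply: Ck_on_sub (smooth_map_chart sf hc he k) => z [cz [ez _]].
  by split.
- exact: smooth_map_chart.
Qed.

Lemma smooth_map_cst M N (y : N) : tame M -> smooth_map (fun _ : M => y).
Proof.
move=> tM; apply: smooth_mapP => [x|c d hc hd k]; first exact: cvg_cst.
exact: Ck_on_cst.
Qed.

Lemma smooth_map_id M : tame M -> smooth_map (@id M).
Proof.
move=> tM; apply: smooth_mapP => [x|c d hc hd k]; first exact: cvg_id.
exact: (tame_compat tM).
Qed.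

Lemma smooth_map_pair M N Q (f : M -> N) (g : M -> Q) :
  tame M -> tame N -> tame Q -> smooth_map f -> smooth_map g ->
  @smooth_map R M (charted_prod N Q) (fun x => (f x, g x)).
Proof.
move=> tM tN tQ sf sg.
have cf := smooth_map_continuous sf; have cg := smooth_map_continuous sg.
apply: smooth_mapP => [x|c e hc [d [d' [hd hd' ->]]] k /=].
  by apply: cvg_pair; [exact: cf|exact: cg].
set V := (X in Ck_on k X _).
have oV : open V.
  apply: chart_preimage_open (tame_chart tM hc) _.
  apply: (@open_comp _ _ (fun x => (f x, g x)) (cdom d `*` cdom d')) => [x _|].
    by apply: cvg_pair; [exact: cf|exact: cg].
  by apply: open_prod; apply: cdom_open; [exact: (tame_chart tN)|exact: (tame_chart tQ)].
apply: Ck_on_pair => //.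
  by apply: Ck_on_sub (smooth_map_chart sf hc hd k) => z [cz [ez _]].
by apply: Ck_on_sub (smooth_map_chart sg hc hd' k) => z [cz [_ ez]].
Qed.

Lemma smooth_map_fst M N : tame M -> tame N ->
  @smooth_map R (charted_prod M N) M fst.
Proof.
move=> tM tN; apply: smooth_mapP => [x|e c' [c [d [hc hd ->]]] hc' k /=].
  exact: cvg_fst.
set U := (X in Ck_on k X _).
have oU : open U.
  apply: (chart_preimage_open
    (is_chart_prod (tame_chart tM hc) (tame_chart tN hd))).
  apply: open_comp; first by move=> x _; exact: cvg_fst.
  exact: cdom_open (tame_chart tM hc').
have oV := chart_preimage_open (tame_chart tM hc) (cdom_open (tame_chart tM hc')).
apply: (Ck_on_comp_fst (f := cmap c' \o cinv c) (tame_fd tM) (tame_fd tM) oU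
  oV _ (tame_compat tM hc hc' k)).
by move=> [y z] [[/= cy dz] c'y].
Qed.

Lemma smooth_map_snd M N : tame M -> tame N ->
  @smooth_map R (charted_prod M N) N snd.
Proof.
move=> tM tN; apply: smooth_mapP => [x|e c' [c [d [hc hd ->]]] hc' k /=].
  exact: cvg_snd.
set U := (X in Ck_on k X _).
have oU : open U.
  apply: (chart_preimage_open
    (is_chart_prod (tame_chart tM hc) (tame_chart tN hd))).
  apply: open_comp; first by move=> x _; exact: cvg_snd.
  exact: cdom_open (tame_chart tN hc').
have oV := chart_preimage_open (tame_chart tN hd) (cdom_open (tame_chart tN hc')).
apply: (Ck_on_comp_snd (f := cmap c' \o cinv d) (tame_fd tN) (tame_fd tN) oU
  oV _ (tame_compat tN hd hc' k)).
by move=> [y z] [[/= cy dz] c'y].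
Qed.

(** Continuity follows from the coordinate expressions, since near each point [f]
    is one of them composed with a chart. *)
Lemma smooth_funP M (f : M -> R) : tame M ->
  smooth_fun f <-> forall c, @ch_atlas R M c ->
    smooth_on (ccod c) (f \o cinv c : _ -> R^o).
Proof.
move=> tM; split=> [sf c hc k|sf].
  have hR : @ch_atlas R (charted_id R^o) (Chart setT setT id id) by [].
  have := smooth_map_chart sf hc hR k.
  by rewrite /= preimage_setT setIT.
apply: smooth_mapP => [x|c d hc -> k]; last first.
  by rewrite /= preimage_setT setIT; exact: sf.
have [c hc cx] := tame_cover tM x; have tc := tame_chart tM hc.
have c1 : {for x, continuous ((f \o cinv c) \o cmap c)}.
  apply: continuous_comp; first exact: cmap_cont.
  by have := sf c hc 0; apply; exact: cmap_cod.
rewrite /continuous_at -[in X in _ --> X](cmapK tc cx).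
apply: cvg_trans c1; apply: near_eq_cvg.
have : \forall y \near nbhs x, cdom c y by apply: open_nbhs_nbhs; split => //; exact: cdom_open.
by apply: filterS => y cy /=; rewrite (cmapK tc).
Qed.

Lemma smooth_fun_cst M (r : R) : tame M -> smooth_fun (fun _ : M => r).
Proof. by move=> tM; exact: smooth_map_cst. Qed.

Lemma smooth_funD M (f g : M -> R) : tame M ->
  smooth_fun f -> smooth_fun g -> smooth_fun (fun x => f x + g x).
Proof.
move=> tM /(smooth_funP _ tM) sf /(smooth_funP _ tM) sg.
apply/(smooth_funP _ tM) => c hc k.
by apply: Ck_onD; [exact: ccod_open (tame_chart tM hc)|exact: sf|exact: sg].
Qed.

Lemma smooth_funM M (f g : M -> R) : tame M ->
  smooth_fun f -> smooth_fun g -> smooth_fun (fun x => f x * g x).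
Proof.
move=> tM /(smooth_funP _ tM) sf /(smooth_funP _ tM) sg.
apply/(smooth_funP _ tM) => c hc k.
by apply: Ck_onM; [exact: ccod_open (tame_chart tM hc)|exact: sf|exact: sg].
Qed.

Lemma smooth_fun_sum M n (r : 'I_n -> R) (f : 'I_n -> M -> R) : tame M ->
  (forall i, smooth_fun (f i)) -> smooth_fun (fun x => \sum_i r i * f i x).
Proof.
move=> tM sf; elim: n r f sf => [|n IH] r f sf.
  by under [X in smooth_fun X]eq_fun do rewrite big_ord0; exact: smooth_fun_cst.
under [X in smooth_fun X]eq_fun do rewrite big_ord_recl.
apply: smooth_funD => //; last by apply: IH.
by apply: smooth_funM => //; exact: smooth_fun_cst.
Qed.

Lemma smooth_fun_comp M N (f : N -> R) (g : M -> N) : tame M -> tame N ->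
  smooth_map g -> smooth_fun f -> smooth_fun (f \o g).
Proof.
move=> tM tN sg sf; apply: smooth_map_comp sg sf => //.
exact: tame_id finite_dim_R.
Qed.

End SmoothMaps.

(** * Tangent vectors *)

Section TangentVectors.
Context (R : realType).

Section Rules.
Context (M : charted R) (tM : tame M) (p : M).
Context (v : (M -> R) -> R) (tv : tangent p v).

Lemma tangent_cst r : v (fun=> r) = 0.
Proof.
have s1 : smooth_fun (fun _ : M => 1) by exact: smooth_fun_cst.
have v1 : v (fun=> 1) = 0.
  have := tangent_leibniz tv s1 s1.
  rewrite (_ : (fun x => _) = (fun=> 1)); last by apply/funext => x; rewrite mul1r.
  by rewrite mulr1 mul1r => /eqP; rewrite -subr_eq0 opprD addNKr oppr_eq0 => /eqP.
have := tangent_linear tv (r - 1) s1 s1.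
rewrite (_ : (fun x => _) = (fun=> r)).
  by rewrite v1 mulr0 addr0.
by apply/funext => x; rewrite mulr1 subrK.
Qed.

Lemma tangentD f h : smooth_fun f -> smooth_fun h ->
  v (fun x => f x + h x) = v f + v h.
Proof.
move=> sf sh; have := tangent_linear tv 1 sf sh.
rewrite (_ : (fun x => _) = (fun x => f x + h x)).
  by rewrite mul1r.
by apply/funext => x; rewrite mul1r.
Qed.

Lemma tangentZ r f : smooth_fun f -> v (fun x => r * f x) = r * v f.
Proof.
move=> sf; have := tangent_linear tv r sf (smooth_fun_cst 0 tM).
rewrite (_ : (fun x => _) = (fun x => r * f x)).
  by rewrite tangent_cst addr0.
by apply/funext => x; rewrite addr0.
Qed.

Lemma tangent_sum n (f : 'I_n -> M -> R) : (forall i, smooth_fun (f i)) ->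
  smooth_fun (fun x => \sum_i f i x) /\
  v (fun x => \sum_i f i x) = \sum_i v (f i).
Proof.
elim: n f => [|n IH] f sf.
  rewrite big_ord0 (_ : (fun x => _) = (fun=> 0)).
    by split; [exact: smooth_fun_cst|exact: tangent_cst].
  by apply/funext => x; rewrite big_ord0.
have [s1 s2] := IH (fun i => f (lift ord0 i)) (fun i => sf _).
rewrite big_ord_recl -s2 -tangentD //.
rewrite (_ : (fun x => \sum_(i < n.+1) f i x)
  = (fun x => f ord0 x + \sum_(i < n) f (lift ord0 i) x)).
  by split=> //; exact: smooth_funD.
by apply/funext => x; rewrite big_ord_recl.
Qed.

End Rules.

Lemma tangent_pushforward (M N : charted R) (F : M -> N) p v :
  tame M -> tame N -> smooth_map F -> tangent p v ->
  tangent (F p) (Defs.pushforward F v).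
Proof.
move=> tM tN sF tv; split=> [r f h sf sh|f h sf sh]; rewrite /Defs.pushforward.
  by rewrite -(tangent_linear tv r) //; exact: smooth_fun_comp.
by rewrite -(tangent_leibniz tv) //; exact: smooth_fun_comp.
Qed.

(** In a Hausdorff space the compact set where the function lives is closed, so
    the extension by zero vanishes near every point outside the chart. *)
Lemma smooth_cutoff (M : manifold R) c (h : ch_model M -> R^o) K :
  @ch_atlas R M c -> smooth_on setT h -> compact K -> K `<=` ccod c ->
  (forall y, ~ K y -> h y = 0) ->
  smooth_fun (fun x : M => if `[< cdom c x >] then h (cmap c x) else 0).
Proof.
move=> hc sh cK Kc h0; have tM := manifold_tame M; have tc := tame_chart tM hc.
set T := (X in smooth_fun X).
apply/(smooth_funP _ tM) => d hd k; have td := tame_chart tM hd.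
apply: Ck_on_local => y dy.
have [cy|ncy] := pselect (cdom c (cinv d y)).
  pose V := ccod d `&` cinv d @^-1` cdom c.
  have oV : open V := chart_preimage_open td (cdom_open tc).
  exists V => //; apply: (@Ck_on_ext _ _ _ _ _ (h \o (cmap c \o cinv d))) => //.
    by move=> z [dz cz] /=; rewrite /T asboolT.
  apply: (Ck_on_comp (tame_fd tM) (finite_dim_R R) oV openT _ _ (sh k)) => //.
  exact: (tame_compat tM hd hc k).
have oK : open (~` (cinv c @` K)).
  apply: closed_openC; apply: compact_closed; first exact: (mfd_hausdorff (mfdP M)).
  apply: continuous_compact => //; apply: continuous_in_subspaceT => z.
  by rewrite inE => /Kc; exact: cinv_cont.
pose V := ccod d `&` cinv d @^-1` (~` (cinv c @` K)).
have oV : open V := chart_preimage_open td oK.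
exists V.
  split=> //= -[z Kz zy]; apply: ncy; rewrite -zy; exact: cinv_dom (Kc _ Kz).
apply: (@Ck_on_ext _ _ _ _ _ (fun=> 0)) => //; last exact: Ck_on_cst.
move=> z [dz nKz]; rewrite /T /=; case: asboolP => // cz.
rewrite h0 // => Kz; apply: nKz; exists (cmap c (cinv d z)) => //.
exact: cmapK.
Qed.

(** Every derivation at [p] is the derivative along a vector of the model
    space: by Hadamard's lemma a smooth function agrees, after multiplication
    by a cutoff, with a first-order polynomial in the coordinates modulo
    products of functions vanishing at [p], on which derivations vanish. *)
Theorem tangent_chart (M : manifold R) (p : M) v c : tangent p v ->
  @ch_atlas R M c -> cdom c p ->
  exists w : ch_model M, forall f : M -> R, smooth_fun f ->
    v f = 'D_w (f \o cinv c : _ -> R^o) (cmap c p).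
Proof.
move=> tv hc cp; have tM := manifold_tame M; have tc := tame_chart tM hc.
have [n [e [a ca]]] := finite_dim_coords (tame_fd tM).
have oc : open (ccod c) := ccod_open tc.
set x0 := cmap c p; have cx0 : ccod c x0 by exact: cmap_cod.
have [rho [K [srho rho1 cK Kc rho0]]] := smooth_bump ca oc cx0.
pose T h (x : M) : R := if `[< cdom c x >] then rho (cmap c x) * h (cmap c x) else 0.
have sT h : smooth_on setT (h : _ -> R^o) -> smooth_fun (T h).
  move=> sh; apply: (smooth_cutoff (h := fun y => rho y * h y : R^o) hc _ cK Kc).
    by move=> k; apply: Ck_onM; [exact: openT|exact: srho|exact: sh].
  by move=> y /rho0 ->; rewrite mul0r.
have Tp h : T h p = h x0.
  by rewrite /T asboolT // -/x0 rho1 mul1r.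
have sa i : smooth_on setT (fun y => a i (y - x0) : R^o).
  move=> k; have -> : (fun y => a i (y - x0) : R^o) = (fun y => a i y + a i (- x0)).
    by apply/funext => y; rewrite linearD.
  apply: Ck_onD; [exact: openT|exact: Ck_on_linear (ca.1 i)|exact: Ck_on_cst].
pose X i := T (fun y => a i (y - x0)).
have sX i : smooth_fun (X i) by exact: sT.
exists (\sum_i v (X i) *: e i) => f sf.
have sfc : smooth_on (ccod c) (f \o cinv c : _ -> R^o) by exact: (proj1 (smooth_funP f tM) sf).
pose F y : R^o := rho y * (f (cinv c y) - f p).
have sF : smooth_on setT F.
  move=> k; apply: Ck_on_local => y _.
  have [Ky|nKy] := pselect (K y).
    exists (ccod c); first exact: Kc.
    apply: Ck_onM => //; first exact: Ck_on_sub (srho k).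
    by apply: Ck_onD oc (sfc k) _; exact: Ck_on_cst.
  exists (~` K) => //.
  have oK : open (~` K) by exact/closed_openC/(compact_closed (@norm_hausdorff _ _)).
  apply: (@Ck_on_ext _ _ _ _ _ (fun=> 0)) => //; last exact: Ck_on_cst.
  by move=> z /rho0 rz; rewrite /F rz mul0r.
have [g [sg gx0 gE]] := hadamard ca x0 sF.
have F0 : F x0 = 0 by rewrite /F /x0 cmapK // subrr mulr0.
pose chi := T (fun=> 1).
have schi : smooth_fun chi by apply: sT => k; exact: Ck_on_cst.
have chip : chi p = 1 by rewrite /chi Tp.
pose f' x := f x - f p.
have sf' : smooth_fun f' by apply: smooth_funD => //; exact: smooth_fun_cst.
(* [F] contains one factor [rho], and each of the two extensions by zero
   contributes another one. *)
have key : (fun x => (chi x * chi x * chi x) * f' x)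
    = (fun x => \sum_i X i x * T (g i) x).
  apply/funext => x; rewrite /chi /X /T; case: asboolP => [cx|_]; last first.
    by rewrite !mul0r big1 // => i _; rewrite mul0r.
  have := gE (cmap c x); rewrite F0 add0r /F (cmapK tc cx) -/(f' x) => E1.
  transitivity (rho (cmap c x) * rho (cmap c x) * (rho (cmap c x) * f' x)).
    by rewrite !mulr1 -!mulrA.
  rewrite E1 mulr_sumr; apply: eq_bigr => i _; ring.
have schi3 : smooth_fun (fun x => chi x * chi x * chi x).
  by do 2! apply: smooth_funM => //.
have vf : v f = v (fun x => (chi x * chi x * chi x) * f' x).
  rewrite (tangent_leibniz tv) // chip !mul1r /f' subrr mulr0 add0r.
  rewrite (tangentD tv) //; last exact: smooth_fun_cst.
  by rewrite (tangent_cst tM tv) addr0.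
have sXT i : smooth_fun (fun x => X i x * T (g i) x).
  by apply: smooth_funM => //; exact: sT.
have [_ vs] := tangent_sum tM tv sXT.
rewrite vf key vs.
have dfc : differentiable (f \o cinv c : _ -> R^o) x0 by have [d _] := sfc 1; exact: d.
have drho : differentiable rho x0 by have [d _] := srho 1; exact: d.
rewrite deriveE // linear_sum; apply: eq_bigr => i _; rewrite linearZ /= -deriveE //.
rewrite (tangent_leibniz tv) //; last exact: sT.
rewrite {2}/X !Tp subrr linear0 mul0r addr0 gx0; congr (_ * _).
rewrite /F.
have -> : (fun y => rho y * (f (cinv c y) - f p) : R^o) =
  (rho * ((f \o cinv c : _ -> R^o) - cst (f p))) by [].
rewrite deriveM; [|exact: diff_derivable|]; last first.
  by apply: derivableB; [exact: diff_derivable|exact: derivable_cst].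
rewrite deriveB; [|exact: diff_derivable|exact: derivable_cst].
rewrite derive_cst subr0 rho1 scale1r !fctE /= /x0 cmapK // subrr scale0r addr0.
by [].
Qed.

Section Partial.
Context (M N : manifold R).
Let tM := manifold_tame M.
Let tN := manifold_tame N.
Let tMN := tame_prod tM tN.
Context (F : charted_prod M N -> R) (sF : smooth_fun F).

Lemma smooth_fun_partial_r (m : M) : smooth_fun (fun n : N => F (m, n)).
Proof.
apply: (@smooth_fun_comp R N (charted_prod M N) F (fun n => (m, n))) => //.
by apply: smooth_map_pair => //; [exact: smooth_map_cst|exact: smooth_map_id].
Qed.

Lemma smooth_fun_partial_l (n : N) : smooth_fun (fun m : M => F (m, n)).
Proof.
apply: (@smooth_fun_comp R M (charted_prod M N) F (fun m => (m, n))) => //.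
by apply: smooth_map_pair => //; [exact: smooth_map_id|exact: smooth_map_cst].
Qed.

Let Phi (c : chart M (ch_model M)) (d : chart N (ch_model N))
  (q : ch_model M * ch_model N) : R^o := F (cinv c q.1, cinv d q.2).

Let sPhi c d : @ch_atlas R M c -> @ch_atlas R N d ->
  smooth_on (ccod c `*` ccod d) (Phi c d).
Proof.
move=> hc hd.
have hcd : @ch_atlas R (charted_prod M N) (Chart (cdom c `*` cdom d) (ccod c `*` ccod d)
   (fun x => (cmap c x.1, cmap d x.2)) (fun y => (cinv c y.1, cinv d y.2))).
  by exists c, d.
exact: (proj1 (smooth_funP F tMN) sF _ hcd).
Qed.

Let derive_r (Psi : (ch_model M * ch_model N)%type -> R^o) y z w :
  'D_w (fun z => Psi (y, z)) z = 'D_(0, w) Psi (y, z).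
Proof.
have E : (fun h : R => h^-1 *: (Psi (y, h *: w + z) - Psi (y, z)))
    = (fun h => h^-1 *: (Psi (h *: (0, w) + (y, z)) - Psi (y, z))).
  apply/funext => h; rewrite (_ : h *: (0, w) + (y, z) = (y, h *: w + z)) //.
  by apply: injective_projections => //=; rewrite scaler0 add0r.
by rewrite /derive /= E.
Qed.

Let derive_l (Psi : (ch_model M * ch_model N)%type -> R^o) y z w :
  'D_w (fun y => Psi (y, z)) y = 'D_(w, 0) Psi (y, z).
Proof.
have E : (fun h : R => h^-1 *: (Psi (h *: w + y, z) - Psi (y, z)))
    = (fun h => h^-1 *: (Psi (h *: (w, 0) + (y, z)) - Psi (y, z))).
  apply/funext => h; rewrite (_ : h *: (w, 0) + (y, z) = (h *: w + y, z)) //.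
  by apply: injective_projections => //=; rewrite scaler0 add0r.
by rewrite /derive /= E.
Qed.

(** In a product of charts, [v] becomes a directional derivative in the second
    variable. *)
Lemma smooth_fun_tangent_r (q : N) v : tangent q v ->
  smooth_fun (fun m : M => v (fun n => F (m, n))).
Proof.
move=> tv; apply/(smooth_funP _ tM) => c hc k.
have [d hd dq] := tame_cover tN q.
have [w wE] := tangent_chart tv hd dq.
have oc : open (ccod c) := ccod_open (tame_chart tM hc).
have od : open (ccod d) := ccod_open (tame_chart tN hd).
apply: (@Ck_on_ext _ _ _ _ _ (fun y => 'D_(0, w) (Phi c d) (y, cmap d q) : R^o)) => //.
  by move=> y cy /=; rewrite wE -?(derive_r (Phi c d)) //; exact: smooth_fun_partial_r.
apply: (@Ck_on_comp _ _ _ _ k (ccod c) (ccod c `*` ccod d)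
    (fun y => (y, cmap d q)) ('D_(0, w) (Phi c d))) => //.
- exact: finite_dim_prod (tame_fd tM) (tame_fd tN).
- exact: finite_dim_R.
- exact: open_prod.
- by move=> y cy; split => //=; exact: cmap_cod (tame_chart tN hd) _ dq.
- apply: Ck_on_pair => //; last exact: Ck_on_cst.
  apply: (@Ck_on_linear _ _ _ k _ (idfun : {linear ch_model M -> ch_model M})).
  by move=> x; exact: cvg_id.
- by apply: Ck_on_derive; exact: sPhi.
Qed.

Lemma smooth_fun_tangent_l (p : M) u : tangent p u ->
  smooth_fun (fun n : N => u (fun m => F (m, n))).
Proof.
move=> tu; apply/(smooth_funP _ tN) => d hd k.
have [c hc cp] := tame_cover tM p.
have [w wE] := tangent_chart tu hc cp.
have oc : open (ccod c) := ccod_open (tame_chart tM hc).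
have od : open (ccod d) := ccod_open (tame_chart tN hd).
apply: (@Ck_on_ext _ _ _ _ _ (fun z => 'D_(w, 0) (Phi c d) (cmap c p, z) : R^o)) => //.
  by move=> z dz /=; rewrite wE -?(derive_l (Phi c d)) //; exact: smooth_fun_partial_l.
apply: (@Ck_on_comp _ _ _ _ k (ccod d) (ccod c `*` ccod d)
    (fun z => (cmap c p, z)) ('D_(w, 0) (Phi c d))) => //.
- exact: finite_dim_prod (tame_fd tM) (tame_fd tN).
- exact: finite_dim_R.
- exact: open_prod.
- by move=> z dz; split => //=; exact: cmap_cod (tame_chart tM hc) _ cp.
- apply: Ck_on_pair => //; first exact: Ck_on_cst.
  apply: (@Ck_on_linear _ _ _ k _ (idfun : {linear ch_model N -> ch_model N})).
  by move=> x; exact: cvg_id.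
- by apply: Ck_on_derive; exact: sPhi.
Qed.

(** Derivations in different variables commute, by the symmetry of second
    derivatives. *)
Lemma tangent_swap (p : M) (q : N) u v : tangent p u -> tangent q v ->
  u (fun m => v (fun n => F (m, n))) = v (fun n => u (fun m => F (m, n))).
Proof.
move=> tu tv.
have [c hc cp] := tame_cover tM p; have [d hd dq] := tame_cover tN q.
have [w wE] := tangent_chart tv hd dq; have [x xE] := tangent_chart tu hc cp.
have oc : open (ccod c) := ccod_open (tame_chart tM hc).
have od : open (ccod d) := ccod_open (tame_chart tN hd).
have cp' := cmap_cod (tame_chart tM hc) cp.
have dq' := cmap_cod (tame_chart tN hd) dq.
transitivity ('D_(x, 0) ('D_(0, w) (Phi c d)) (cmap c p, cmap d q)).
  rewrite (xE _ (smooth_fun_tangent_r tv)).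
  rewrite -derive_l; apply: near_eq_derive.
  have : \forall y \near nbhs (cmap c p), ccod c y by exact: open_nbhs_nbhs.
  apply: filterS => y cy /=.
  by rewrite wE -?(derive_r (Phi c d)) //; exact: smooth_fun_partial_r.
rewrite (derive_swap (U := ccod c `*` ccod d)); first last.
- exact: sPhi.
- by [].
- exact: open_prod.
rewrite (wE _ (smooth_fun_tangent_l tu)).
rewrite -derive_r; apply: near_eq_derive.
have : \forall y \near nbhs (cmap d q), ccod d y by exact: open_nbhs_nbhs.
apply: filterS => y dy /=.
by rewrite xE -?(derive_l (Phi c d)) //; exact: smooth_fun_partial_l.
Qed.

End Partial.

End TangentVectors.

(** * The Lie algebra and the adjoint action *)

Section LieGroup.
Context (R : realType) (G : lie_group R).
Implicit Types a b c : G.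

Local Notation "a '*g' b" := (lg_mul a b) (at level 40, left associativity).
Local Notation "a '^g'" := (lg_inv a) (at level 2, format "a '^g'").
Local Notation e := (lg_one G).

Lemma lg_mulVr a : a *g a^g = e.
Proof.
rewrite -[LHS](lg_mul1 _) -[X in X *g _](lg_mulV (a^g)) -lg_mulA (lg_mulA a^g).
by rewrite lg_mulV lg_mul1 lg_mulV.
Qed.

Lemma lg_mulr1 a : a *g e = a.
Proof. by rewrite -(lg_mulV a) lg_mulA lg_mulVr lg_mul1. Qed.

Lemma lg_mulKV a b : a *g b *g b^g = a.
Proof. by rewrite -lg_mulA lg_mulVr lg_mulr1. Qed.

Lemma lg_mulVK a b : a *g b^g *g b = a.
Proof. by rewrite -lg_mulA lg_mulV lg_mulr1. Qed.

Lemma lg_inv_uniq a b : a *g b = e -> b = a^g.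
Proof. by move=> h; rewrite -[RHS]lg_mulr1 -h lg_mulA lg_mulV lg_mul1. Qed.

Lemma lg_invM a b : (a *g b)^g = b^g *g a^g.
Proof. by apply/esym/lg_inv_uniq; rewrite lg_mulA lg_mulKV lg_mulVr. Qed.

Lemma lg_invK a : a^g^g = a.
Proof. by apply/esym/lg_inv_uniq; exact: lg_mulV. Qed.

Lemma lg_inv1 : e^g = e.
Proof. by apply/esym/lg_inv_uniq; rewrite lg_mul1. Qed.

Let tG := manifold_tame G.
Let tGG := tame_prod tG tG.

Lemma smooth_lg_mul (M : charted R) (f h : M -> G) : tame M ->
  smooth_map f -> smooth_map h -> @smooth_map R M G (fun x => f x *g h x).
Proof.
move=> tM sf sh.
apply: (@smooth_map_comp R M (charted_prod G G) G (fun x => (f x, h x))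
  (fun q => q.1 *g q.2)) => //; first exact: smooth_map_pair.
exact: lg_mul_smooth.
Qed.

Lemma smooth_lg_inv (M : charted R) (f : M -> G) : tame M ->
  smooth_map f -> @smooth_map R M G (fun x => (f x)^g).
Proof.
move=> tM sf; apply: (@smooth_map_comp R M G G f (fun a => a^g)) => //.
exact: lg_inv_smooth.
Qed.

Lemma smooth_lmul a : @smooth_map R G G (fun b => a *g b).
Proof. by apply: smooth_lg_mul => //; [exact: smooth_map_cst|exact: smooth_map_id]. Qed.

Lemma smooth_rmul a : @smooth_map R G G (fun b => b *g a).
Proof. by apply: smooth_lg_mul => //; [exact: smooth_map_id|exact: smooth_map_cst]. Qed.

Lemma smooth_conj a : @smooth_map R G G (fun b => a *g b *g a^g).
Proof.
by apply: smooth_lg_mul => //; [exact: smooth_lmul|exact: smooth_map_cst].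
Qed.

Lemma smooth_fun_mul_swap (f : G -> R) : smooth_fun f ->
  @smooth_fun R (charted_prod G G) (fun q => f (q.2 *g q.1)).
Proof.
move=> sf; apply: (@smooth_fun_comp R (charted_prod G G) G f (fun q => q.2 *g q.1)) => //.
by apply: smooth_lg_mul => //; [exact: smooth_map_snd|exact: smooth_map_fst].
Qed.

Lemma smooth_fun_conj (f : G -> R) : smooth_fun f ->
  @smooth_fun R (charted_prod G G) (fun q => f (q.1 *g q.2 *g q.1^g)).
Proof.
move=> sf; apply: (@smooth_fun_comp R (charted_prod G G) G f
  (fun q => q.1 *g q.2 *g q.1^g)) => //.
apply: smooth_lg_mul => //; first exact: lg_mul_smooth.
by apply: smooth_lg_inv => //; exact: smooth_map_fst.
Qed.

Section LieAlgebra.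
Context (g : lie_algebra G).
Implicit Types x y z : g.

Local Notation "\[ x , y \]" := (la_bracket x y) (at level 0).

Lemma la_tangentP x : tangent e (la_tangent x).
Proof. exact: (field_tangent (la_field_vector x)). Qed.

Lemma smooth_la_field x (f : G -> R) : smooth_fun f -> smooth_fun (la_field x f).
Proof. exact: (field_smooth (la_field_vector x)). Qed.

Lemma la_fieldE x (f : G -> R) a : smooth_fun f ->
  la_field x f a = la_tangent x (fun b => f (a *g b)).
Proof.
by move=> sf; rewrite /la_tangent /field_at (la_field_left x) // lg_mulr1.
Qed.

Lemma la_tangent_linear k x y (f : G -> R) : smooth_fun f ->
  la_tangent (k *: x + y) f = k * la_tangent x f + la_tangent y f.
Proof. by move=> sf; exact: la_field_linear. Qed.

Lemma la_tangent_inj x y : (forall f : G -> R, smooth_fun f ->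
  la_tangent x f = la_tangent y f) -> x = y.
Proof.
move=> xy; apply: la_field_inj => f sf; apply/funext => a.
rewrite !la_fieldE // xy //.
exact: (smooth_fun_comp (g := fun b => a *g b)) (smooth_lmul a) sf.
Qed.

Lemma la_tangent0 (f : G -> R) : smooth_fun f -> la_tangent (0 : g) f = 0.
Proof.
move=> sf; have := la_tangent_linear (-1) 0 0 sf.
by rewrite scaler0 addr0 mulN1r addNr.
Qed.

Lemma la_tangent_sum n (k : 'I_n -> R) (x : 'I_n -> g) (f : G -> R) :
  smooth_fun f ->
  la_tangent (\sum_i k i *: x i) f = \sum_i k i * la_tangent (x i) f.
Proof.
move=> sf; elim: n k x => [|n IH] k x; first by rewrite !big_ord0 la_tangent0.
by rewrite !big_ord_recl la_tangent_linear // IH.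
Qed.

Section Adjoint.

(** Right translation by [a^-1] maps left-invariant fields to left-invariant
    fields, and it has the same effect on them as conjugation by [a]. *)
Lemma Ad_exists a x : exists y : g, forall f : G -> R, smooth_fun f ->
  la_tangent y f = la_tangent x (fun b => f (a *g b *g a^g)).
Proof.
pose Z (f : G -> R) b := la_field x (fun c => f (c *g a^g)) (b *g a).
have sr (f : G -> R) : smooth_fun f -> smooth_fun (fun c => f (c *g a^g)).
  exact: (smooth_fun_comp (g := fun c => c *g a^g)) (smooth_rmul _).
have Zv : @vector_field R G Z.
  split=> [b|f sf].
    have := tangent_pushforward tG tG (smooth_rmul a^g)
      (field_tangent (la_field_vector x) (b *g a)).
    by rewrite lg_mulKV.
  exact: (smooth_fun_comp (g := fun c => c *g a)) (smooth_rmul _)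
    (smooth_la_field _ (sr _ sf)).
have Zl : left_invariant Z.
  move=> a' f sf b; rewrite /Z -lg_mulA -(la_field_left x a' (sr f sf)).
  by congr (la_field x _ _); apply/funext => c; rewrite lg_mulA.
have [y yE] := @la_field_surj R G g Z Zv Zl.
exists y => f sf; rewrite /la_tangent /field_at yE // /Z lg_mul1.
rewrite la_fieldE //; exact: sr.
Qed.

Lemma AdE a x (f : G -> R) : smooth_fun f ->
  la_tangent (Ad a x) f = la_tangent x (fun b => f (a *g b *g a^g)).
Proof.
have [y yE] := Ad_exists a x.
have := @xgetPex g 0 [set y | @eq_tangent R G (la_tangent y)
    (Defs.pushforward (fun b : G => (a *g b *g a^g) : G) (la_tangent x))].
by move=> /(_ (ex_intro _ y yE)) H sf; exact: H.
Qed.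

Let Ad_test x (f : G -> R) a : smooth_fun f ->
  smooth_fun (fun b => f (a *g b *g a^g)).
Proof. exact: (smooth_fun_comp (g := fun b => a *g b *g a^g)) (smooth_conj _). Qed.

Lemma Ad_linear a : linear (@Ad R G g a).
Proof.
move=> k x y; apply: la_tangent_inj => f sf; rewrite AdE // !la_tangent_linear //.
  by rewrite !AdE.
exact: Ad_test.
Qed.

HB.instance Definition _ a := GRing.isLinear.Build R g g _ (@Ad R G g a) (Ad_linear a).

Lemma Ad1 x : Ad e x = x.
Proof.
apply: la_tangent_inj => f sf; rewrite AdE //.
by congr (la_tangent x _); apply/funext => b; rewrite lg_inv1 lg_mulr1 lg_mul1.
Qed.

Lemma AdM a b x : Ad (a *g b) x = Ad a (Ad b x).
Proof.
apply: la_tangent_inj => f sf; rewrite !AdE //; last exact: Ad_test.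
by congr (la_tangent x _); apply/funext => c; rewrite lg_invM !lg_mulA.
Qed.

Lemma AdK a : cancel (@Ad R G g a) (Ad a^g).
Proof. by move=> x; rewrite -AdM lg_mulV Ad1. Qed.

Lemma AdKV a : cancel (@Ad R G g a^g) (Ad a).
Proof. by move=> x; rewrite -AdM lg_mulVr Ad1. Qed.

Lemma Ad_field a x (f : G -> R) b : smooth_fun f ->
  la_field (Ad a x) f b = la_field x (fun c => f (c *g a^g)) (b *g a).
Proof.
move=> sf; rewrite la_fieldE // AdE ?la_fieldE //.
- by congr (la_tangent x _); apply/funext => c; rewrite !lg_mulA.
- exact: (smooth_fun_comp (g := fun c => c *g a^g)) (smooth_rmul _) sf.
- exact: (smooth_fun_comp (g := fun c => b *g c)) (smooth_lmul _) sf.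
Qed.

Lemma la_tangent_bracket x y (f : G -> R) : smooth_fun f ->
  la_tangent \[x, y\] f = la_tangent x (la_field y f) - la_tangent y (la_field x f).
Proof. by move=> sf; rewrite {1}/la_tangent /field_at la_bracketE. Qed.

Lemma Ad_bracket a x y : Ad a \[x, y\] = \[Ad a x, Ad a y\].
Proof.
apply: la_tangent_inj => f sf; rewrite la_tangent_bracket // /la_tangent /field_at.
have sr : smooth_fun (fun c => f (c *g a^g)).
  exact: (smooth_fun_comp (g := fun c => c *g a^g)) (smooth_rmul _) sf.
rewrite !Ad_field //; do ?exact: smooth_la_field.
rewrite la_bracketE // /field_bracket.
have E x' : (fun c => la_field (Ad a x') f (c *g a^g))
    = la_field x' (fun c => f (c *g a^g)).
  by apply/funext => c; rewrite Ad_field // lg_mulVK.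
by rewrite !E.
Qed.

End Adjoint.

Lemma bracketC x y : \[x, y\] = - \[y, x\].
Proof.
apply: la_tangent_inj => f sf; rewrite la_tangent_bracket //.
have := la_tangent_linear (-1) \[y, x\] 0 sf.
by rewrite scaleN1r addr0 la_tangent0 // addr0 mulN1r => ->;
  rewrite la_tangent_bracket // opprB.
Qed.

Lemma bracket_linear_r x : linear (la_bracket x).
Proof.
move=> k y z; apply: la_tangent_inj => f sf.
rewrite la_tangent_linear // !la_tangent_bracket // la_tangent_linear; last exact: smooth_la_field.
have -> : la_field (k *: y + z) f = (fun b => k * la_field y f b + la_field z f b).
  by apply/funext => b; exact: la_field_linear.
rewrite (tangent_linear (la_tangentP x)); [|exact: smooth_la_field..].
ring.
Qed.

Lemma bracket_linear_l x : linear (fun y => \[y, x\]).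
Proof.
move=> k y z; rewrite bracketC bracket_linear_r opprD -scalerN.
by rewrite -!(bracketC _ x).
Qed.

HB.instance Definition _ x :=
  GRing.isLinear.Build R g g _ (la_bracket x) (bracket_linear_r x).

Lemma bracketDl x y z : \[x + y, z\] = \[x, z\] + \[y, z\].
Proof. by have := bracket_linear_l z 1 x y; rewrite !scale1r. Qed.

Lemma bracketZl k x z : \[k *: x, z\] = k *: \[x, z\].
Proof.
have := bracket_linear_l z k x 0; rewrite addr0 => ->.
by rewrite (bracketC 0) linear0 oppr0 addr0.
Qed.

Lemma bracket0l z : \[0, z\] = 0.
Proof. by rewrite bracketC linear0 oppr0. Qed.

Lemma jacobi x y z : \[x, \[y, z\]\] = \[\[x, y\], z\] + \[y, \[x, z\]\].
Proof.
have tD u v (f : G -> R) : smooth_fun f ->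
    la_tangent (u + v : g) f = la_tangent u f + la_tangent v f.
  by move=> sf; rewrite -{1}[u]scale1r la_tangent_linear // mul1r.
have fB u v (f : G -> R) : smooth_fun f -> la_field \[u, v\] f =
    (fun b => (-1) * la_field v (la_field u f) b + la_field u (la_field v f) b).
  by move=> sf; rewrite la_bracketE //; apply/funext => b; rewrite mulN1r addrC.
apply: la_tangent_inj => f sf; rewrite tD // !la_tangent_bracket //.
rewrite !fB // !(tangent_linear (la_tangentP _)) //; do ?exact: smooth_la_field;
  do ?(by do !apply: smooth_la_field).
  ring.
all: exact: smooth_la_field.
Qed.

Let n := \dim {:g}.
Let bs := vbasis {:g}.

Lemma coord_vbasisE x : x = \sum_(i < n) coord bs i x *: bs`_i.
Proof. by apply: coord_basis (memvf x); exact: vbasisP. Qed.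

(** The derivatives at the identity of smooth functions fill the dual of the
    Lie algebra: otherwise they would all vanish on some nonzero vector. *)
Lemma functional_la_tangent (l : {linear g -> R^o}) :
  exists2 f : G -> R, smooth_fun f & forall x, la_tangent x f = l x.
Proof.
pose r (f : G -> R) : 'rV[R]_n := \row_j la_tangent (bs`_j : g) f.
have rE f x : smooth_fun f -> la_tangent x f = (r f *m (\col_j coord bs j x)) 0 0.
  move=> sf; rewrite {1}(coord_vbasisE x) la_tangent_sum // mxE.
  by apply: eq_bigr => j _; rewrite !mxE mulrC.
have [m [f [sf Bf]]] : exists m (f : 'I_m -> G -> R), (forall i, smooth_fun (f i)) /\
    row_full (\matrix_i r (f i)).
  have H k : (k <= n)%N -> exists m (f : 'I_m -> G -> R),
      (forall i, smooth_fun (f i)) /\ (k <= \rank (\matrix_i r (f i)))%N.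
    elim: k => [_|k IH kn]; first by exists 0, (fun _ _ => 0); split => // -[].
    have [m [f [sf fk]]] := IH (ltnW kn).
    set B := \matrix_i r (f i) in fk *.
    have [kB|kB] := ltnP k (\rank B); first by exists m, f.
    have rkB : \rank B = k by apply/eqP; rewrite eqn_leq kB fk.
    (* a nonzero tangent vector that kills all the [f i]; a function on which it
       does not vanish increases the rank *)
    have /rowV0Pn[y yK y0] : kermx B^T != 0.
      by rewrite -mxrank_eq0 mxrank_ker mxrank_tr rkB subn_eq0 -ltnNge.
    have By : B *m y^T = 0.
      by apply: trmx_inj; rewrite trmx_mul trmxK trmx0; exact/sub_kermxP.
    pose x : g := \sum_j y 0 j *: bs`_j.
    have yx : \col_j coord bs j x = y^T.
      apply/colP => j; rewrite !mxE /x.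
      by rewrite (coord_sum_free (fun j => y 0 j)) //; exact: basis_free (vbasisP _).
    have [h sh hx] : exists2 h : G -> R, smooth_fun h & la_tangent x h != 0.
      apply: contrapT => nh; move/negP: y0; apply; apply/eqP.
      have x0 : x = 0.
        apply: la_tangent_inj => h sh; rewrite la_tangent0 //.
        by apply: contrapT => /eqP hx; apply: nh; exists h.
      apply: trmx_inj; rewrite -yx x0 trmx0.
      by apply/colP => j; rewrite !mxE linear0.
    exists (m + 1)%N, (fun i : 'I_(m + 1) =>
      match fintype.split i with inl j => f j | inr _ => h end); split.
      by move=> i; case: fintype.split.
    set B' := \matrix_i _.
    have B'E : B' = col_mx B (r h).
      apply/row_matrixP => i; rewrite rowK; case: (fintype.splitP i) => j ij.
        have -> : i = lshift 1 j by apply: val_inj.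
        by rewrite rowKu rowK.
      have -> : i = rshift m j by apply: val_inj.
      by rewrite rowKd row_id // [j]ord1 row_id.
    have BB' : (B <= B')%MS by rewrite B'E; apply: submx_trans (addsmxSl _ _) _; rewrite addsmxE.
    rewrite ltnNge; apply/negP => rB'.
    have B'B : (B' <= B)%MS by rewrite -(geq_leqif (mxrank_leqif_sup BB')) rkB.
    have /submxP[D DE] : (r h <= B)%MS.
      by apply: submx_trans B'B; rewrite B'E; apply: submx_trans (addsmxSr B _) _; rewrite addsmxE.
    by move: hx; rewrite rE // yx DE -mulmxA By mulmx0 mxE eqxx.
  have [m [f [sf fr]]] := H n (leqnn n).
  by exists m, f; split => //; rewrite /row_full eqn_leq rank_leq_col.
have /submxP[D DE] := submx_full (\row_j l bs`_j : 'rV_n) Bf.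
exists (fun a => \sum_i D 0 i * f i a).
  exact: smooth_fun_sum.
move=> x.
have sfi i : smooth_fun (fun a => D 0 i * f i a).
  by apply: smooth_funM => //; exact: smooth_fun_cst.
have [_ ->] := tangent_sum tG (la_tangentP x) sfi.
under eq_bigr do rewrite (tangentZ tG (la_tangentP x)) // rE //.
rewrite {2}(coord_vbasisE x) linear_sum.
have lE j : l (coord bs j x *: bs`_j) = coord bs j x * (\sum_i D 0 i * r (f i) 0 j).
  rewrite linearZ /=; congr (_ * _).
  have := congr1 (fun A : 'rV_n => A 0 j) DE; rewrite !mxE => ->.
  by apply: eq_bigr => i _; rewrite !mxE.
under [RHS]eq_bigr do rewrite lE mulr_sumr.
rewrite exchange_big /=; apply: eq_bigr => i _.
rewrite mxE mulr_sumr; apply: eq_bigr => j _.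
by rewrite !mxE; ring.
Qed.

(** A linear functional of [Ad a x] is the derivative along [x] of
    [b |-> f (a b a^-1)] for a suitable [f]. *)
Lemma smooth_Ad (l : {linear g -> R^o}) x : smooth_fun (fun a => l (Ad a x)).
Proof.
have [f sf fE] := functional_la_tangent l.
have -> : (fun a => l (Ad a x)) = (fun a => la_tangent x (fun b => f (a *g b *g a^g))).
  by apply/funext => a; rewrite -fE AdE.
exact: (smooth_fun_tangent_r (smooth_fun_conj sf) (la_tangentP x)).
Qed.

(** The derivative of [Ad] at the identity is [ad]. Since [a b = (a b a^-1) a],
    differentiating [f (a b)] in [a] produces the derivative of [Ad] and, by
    the product rule, the derivative of [f (b a)]; the two mixed derivatives
    of the latter commute. *)
Lemma derive_Ad (l : {linear g -> R^o}) x y :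
  la_tangent x (fun a => l (Ad a y)) = l \[x, y\].
Proof.
pose D : g := \sum_(j < n) la_tangent x (fun a => coord bs j (Ad a y)) *: bs`_j.
have lD (l' : {linear g -> R^o}) : la_tangent x (fun a => l' (Ad a y)) = l' D.
  have -> : (fun a => l' (Ad a y))
      = (fun a => \sum_(j < n) l' bs`_j * coord bs j (Ad a y)).
    apply/funext => a; rewrite {1}(coord_vbasisE (Ad a y)) linear_sum.
    by apply: eq_bigr => j _; rewrite linearZ /= mulrC.
  have sj (j : 'I_n) : smooth_fun (fun a => l' bs`_j * coord bs j (Ad a y)).
    by apply: smooth_funM => //; [exact: smooth_fun_cst|exact: (smooth_Ad (coord bs j))].
  have [_ ->] := tangent_sum tG (la_tangentP x) sj.
  rewrite /D linear_sum; apply: eq_bigr => j _; rewrite linearZ /=.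
  by rewrite (tangentZ tG (la_tangentP x)) 1?mulrC //; exact: (smooth_Ad (coord bs j)).
rewrite lD; congr (l _); apply: la_tangent_inj => f sf.
rewrite la_tangent_bracket //.
have sR a : smooth_fun (fun c => f (c *g a)).
  exact: (smooth_fun_comp (g := fun c => c *g a)) (smooth_rmul _) sf.
have -> : la_field y f = fun a =>
    \sum_(j < n) coord bs j (Ad a y) * la_tangent (bs`_j : g) (fun c => f (c *g a)).
  apply/funext => a; rewrite la_fieldE // -la_tangent_sum // -coord_vbasisE.
  by rewrite AdE //; congr (la_tangent y _); apply/funext => c; rewrite lg_mulVK.
have sA (j : 'I_n) : smooth_fun (fun a => coord bs j (Ad a y)) := smooth_Ad (coord bs j) y.
have sT (j : 'I_n) : smooth_fun (fun a : G => la_tangent (bs`_j : g) (fun c => f (c *g a))).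
  exact: (smooth_fun_tangent_r (smooth_fun_mul_swap sf) (la_tangentP _)).
have sAT j := smooth_funM tG (sA j) (sT j).
have [_ ->] := tangent_sum tG (la_tangentP x) sAT.
have xf : la_tangent y (la_field x f) = \sum_(j < n)
    coord bs j (Ad e y) * la_tangent x (fun a => la_tangent (bs`_j : g) (fun c => f (c *g a))).
  rewrite {1}(coord_vbasisE y) la_tangent_sum; last exact: smooth_la_field.
  apply: eq_bigr => j _; rewrite Ad1; congr (_ * _).
  rewrite (tangent_swap (smooth_fun_mul_swap sf) (la_tangentP x) (la_tangentP _)) /=.
  by congr (la_tangent _ _); apply/funext => c; rewrite la_fieldE.
rewrite xf -sumrB la_tangent_sum //; apply: eq_bigr => j _.
rewrite (tangent_leibniz (la_tangentP x) (sA j) (sT j)) addrK; congr (_ * _).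
by congr (la_tangent _ _); apply/funext => c; rewrite lg_mulr1.
Qed.

End LieAlgebra.
End LieGroup.

(** * Orthonormal bases *)

Section InnerProducts.
Context (R : realType) (V : vectType R).
Implicit Types (B : V -> V -> R) (x y z : V).

Definition bilinear_form B : Prop :=
  (forall k x y z, B (k *: x + y) z = k * B x z + B y z) /\
  (forall k x y z, B z (k *: x + y) = k * B z x + B z y).

Definition inner_product B : Prop :=
  [/\ bilinear_form B, forall x y, B x y = B y x &
    forall x, x != 0 -> 0 < B x x].

Section Bilinear.
Context (B : V -> V -> R) (bB : bilinear_form B).

Lemma bform0l z : B 0 z = 0.
Proof.
by have := bB.1 (-1) 0 0 z; rewrite scaler0 addr0 mulN1r addNr.
Qed.

Lemma bform0r z : B z 0 = 0.
Proof.
by have := bB.2 (-1) 0 0 z; rewrite scaler0 addr0 mulN1r addNr.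
Qed.

Lemma bformDl x y z : B (x + y) z = B x z + B y z.
Proof. by rewrite -{1}[x]scale1r bB.1 mul1r. Qed.

Lemma bformDr x y z : B z (x + y) = B z x + B z y.
Proof. by rewrite -{1}[x]scale1r bB.2 mul1r. Qed.

Lemma bformZl k x z : B (k *: x) z = k * B x z.
Proof. by rewrite -[k *: x]addr0 bB.1 bform0l addr0. Qed.

Lemma bformZr k x z : B z (k *: x) = k * B z x.
Proof. by rewrite -[k *: x]addr0 bB.2 bform0r addr0. Qed.

Lemma bformNl x z : B (- x) z = - B x z.
Proof. by rewrite -scaleN1r bformZl mulN1r. Qed.

Lemma bformNr x z : B z (- x) = - B z x.
Proof. by rewrite -scaleN1r bformZr mulN1r. Qed.

Lemma bform_suml n (k : 'I_n -> R) (x : 'I_n -> V) z :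
  B (\sum_i k i *: x i) z = \sum_i k i * B (x i) z.
Proof.
elim: n k x => [|n IH] k x; first by rewrite !big_ord0 bform0l.
by rewrite !big_ord_recl bformDl bformZl IH.
Qed.

Lemma bform_sumr n (k : 'I_n -> R) (x : 'I_n -> V) z :
  B z (\sum_i k i *: x i) = \sum_i k i * B z (x i).
Proof.
elim: n k x => [|n IH] k x; first by rewrite !big_ord0 bform0r.
by rewrite !big_ord_recl bformDr bformZr IH.
Qed.

End Bilinear.

Definition orthonormal_family B n (e : 'I_n -> V) : Prop :=
  forall i j, B (e i) (e j) = (i == j)%:R.

Lemma orthonormal_free B n (e : 'I_n -> V) : bilinear_form B ->
  orthonormal_family B e -> (n <= \dim {:V})%N.
Proof.
move=> bB oe; pose X := [tuple e i | i < n].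
suff fX : free X.
  by rewrite -[n](size_tuple X) -(eqP fX); exact: dimvS (subvf _).
apply/freeP => k; under eq_bigr do rewrite -tnth_nth tnth_mktuple.
move=> k0 i; have := congr1 (B ^~ (e i)) k0.
rewrite bform0l // bform_suml // (bigD1 i) //= oe eqxx mulr1 big1 ?addr0 // => j ji.
by rewrite oe (negPf ji) mulr0.
Qed.

(** An orthonormal family in [W] of maximal length spans [W]: a vector outside its
    span would have a nonzero component orthogonal to it, which extends it. *)
Lemma orthonormal_basis_sub B (W : {vspace V}) : inner_product B ->
  exists n (e : 'I_n -> V), [/\ orthonormal_family B e, forall i, e i \in W &
    forall x, x \in W -> x = \sum_i B x (e i) *: e i].
Proof.
case=> bB sB pB.
pose P n := `[< exists e : 'I_n -> V, orthonormal_family B e /\ forall i, e i \in W >].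
have exP : exists n, P n.
  by exists 0; apply/asboolP; exists (fun _ => 0); split; case.
have Pn n : P n -> (n <= \dim {:V})%N.
  by move=> /asboolP[e [oe _]]; exact: orthonormal_free oe.
have [n /asboolP[e [oe eW]] nmax] := ex_maxnP exP Pn.
exists n, e; split=> // x xW; apply: contrapT => /eqP.
rewrite -subr_eq0; set x' := _ - _ => x'0.
have x'W : x' \in W.
  by rewrite rpredB // rpred_sum // => i _; rewrite rpredZ.
have x'e i : B x' (e i) = 0.
  rewrite /x' bformDl // bformNl // bform_suml // (bigD1 i) //= oe eqxx mulr1.
  by rewrite big1 ?addr0 ?subrr // => j ji; rewrite oe (negPf ji) mulr0.
pose s := Num.sqrt (B x' x'); have s0 : s != 0.
  by rewrite gt_eqF // sqrtr_gt0 pB.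
pose f (i : 'I_n.+1) := if unlift ord0 i is Some j then e j else s^-1 *: x'.
have : P n.+1.
  apply/asboolP; exists f; split=> [i j|i]; rewrite /f; last first.
    by case: (unliftP ord0 i) => [i'|] _ //; rewrite rpredZ.
  case: (unliftP ord0 i) => [i'|] ->; case: (unliftP ord0 j) => [j'|] ->.
  - by rewrite oe (inj_eq lift_inj).
  - by rewrite bformZr // sB x'e mulr0.
  - by rewrite bformZl // x'e mulr0.
  - rewrite bformZl // bformZr // mulrA -[X in _ * X]sqr_sqrtr ?ltW ?pB // -/s.
    by rewrite eqxx expr2 mulrA mulfVK // mulVf.
by move=> /nmax; rewrite ltnn.
Qed.

Lemma orthonormal_basis B : inner_product B ->
  exists n (e : 'I_n -> V), orthonormal_family B e /\
    forall x, x = \sum_i B x (e i) *: e i.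
Proof.
move=> iB; have [n [e [oe _ eE]]] := orthonormal_basis_sub fullv iB.
by exists n, e; split=> // x; apply: eE; exact: memvf.
Qed.

(** Parseval's identity. *)
Lemma orthonormal_form B n (e : 'I_n -> V) x y : inner_product B ->
  (forall x, x = \sum_i B x (e i) *: e i) ->
  B x y = \sum_i B (e i) x * B (e i) y.
Proof.
move=> [bB sB pB] eE; rewrite {1}(eE x) bform_suml //.
by apply: eq_bigr => i _; rewrite (sB x).
Qed.

(** Expand the vectors of the given basis in [e] and the [T (e k)] in the given
    basis: the two sums have the same terms. *)
Lemma trace_orthonormal B n (e : 'I_n -> V) (T : {linear V -> V}) :
  inner_product B -> orthonormal_family B e ->
  (forall x, x = \sum_i B x (e i) *: e i) ->
  \sum_(i < \dim {:V}) coord (vbasis {:V}) i (T (vbasis {:V})`_i) =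
  \sum_k B (T (e k)) (e k).
Proof.
move=> [bB sB pB] oe eE; set bs := vbasis _.
have bE x : x = \sum_(i < \dim {:V}) coord bs i x *: bs`_i.
  by apply: coord_basis (memvf x); exact: vbasisP.
transitivity (\sum_(i < \dim {:V}) \sum_k B bs`_i (e k) * coord bs i (T (e k))).
  apply: eq_bigr => i _; rewrite [X in T X]eE !linear_sum.
  by apply: eq_bigr => k _; rewrite !linearZ.
rewrite exchange_big; apply: eq_bigr => k _ /=.
rewrite [X in B X _](bE (T (e k))) bform_suml //.
by apply: eq_bigr => i _; rewrite mulrC.
Qed.

End InnerProducts.

(** * Second-order conditions at a minimum *)

Section Jets.
Context (R : realType).
Implicit Types f h : R -> R^o.

(** [b] and [c] are the first and second derivatives of [f] at [0]. *)
Definition jet2 f (b c : R) : Prop := exists f1 : R -> R^o,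
  [/\ \forall t \near (0 : R), is_derive (t : R) 1 f (f1 t), f1 0 = b &
    is_derive (0 : R) 1 f1 c].

Lemma jet2_cst k : jet2 (fun=> k) 0 0.
Proof.
exists (fun=> 0); split=> //; last exact: is_derive_cst.
by near=> t; exact: is_derive_cst.
Unshelve. all: by end_near. Qed.

Lemma jet2D f h b c b' c' : jet2 f b c -> jet2 h b' c' ->
  jet2 (fun t => f t + h t) (b + b') (c + c').
Proof.
move=> [f1 [df f10 df1]] [h1 [dh h10 dh1]].
exists (fun t => f1 t + h1 t); split; last exact: is_deriveD.
  by apply: filterS2 df dh => t df dh; exact: is_deriveD.
by rewrite f10 h10.
Qed.

Lemma jet2M f h b c b' c' : jet2 f b c -> jet2 h b' c' ->
  jet2 (fun t => f t * h t) (b * h 0 + f 0 * b')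
    (c * h 0 + 2 * (b * b') + f 0 * c').
Proof.
move=> [f1 [df f10 df1]] [h1 [dh h10 dh1]].
exists (fun t => f1 t * h t + f t * h1 t); split.
- apply: filterS2 df dh => t df dh.
  by apply: is_derive_eq; rewrite -![_ *: _]/(_ * _); ring.
- by rewrite f10 h10.
- have df0 := nbhs_singleton df; have dh0 := nbhs_singleton dh.
  apply: is_derive_eq.
  by rewrite -![_ *: _]/(_ * _) f10 h10; ring.
Qed.

Lemma jet2_sum n (f : 'I_n -> R -> R^o) b c : (forall i, jet2 (f i) (b i) (c i)) ->
  jet2 (fun t => \sum_i f i t) (\sum_i b i) (\sum_i c i).
Proof.
elim: n f b c => [|n IH] f b c jf.
  rewrite !big_ord0; under [X in jet2 X]eq_fun do rewrite big_ord0.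
  exact: jet2_cst.
rewrite !big_ord_recl; under [X in jet2 X]eq_fun do rewrite big_ord_recl.
by apply: jet2D => //; apply: IH.
Qed.

Lemma jet2_scale f b c s : jet2 f b c ->
  jet2 (fun t => f (s * t)) (s * b) (s ^+ 2 * c).
Proof.
move=> [f1 [df f10 df1]].
have ds (t : R) : is_derive t 1 (fun t : R => s * t) s.
  have := is_deriveZ s (is_derive_id t 1); rewrite [_ *: 1]mulr1.
  by rewrite (_ : s \*: id = fun t => s * t).
exists (fun t => s * f1 (s * t)); split; last 1 first.
- have df1' : is_derive (s * 0) 1 f1 c by rewrite mulr0.
  have := is_deriveZ s (is_derive1_comp df1' (ds 0)).
  by rewrite expr2 -mulrA [c * s]mulrC.
- have cs : (fun t : R => s * t) @ (0 : R) --> (0 : R).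
    rewrite -[X in _ --> X](mulr0 s).
    by apply: cvgMl_tmp; exact: cvg_id.
  have H : \forall t \near (0 : R), is_derive (s * t : R) 1 f (f1 (s * t)).
    exact: (cs _ df).
  near=> t; have dft : is_derive (s * t : R) 1 f (f1 (s * t)) by near: t.
  by have := is_derive1_comp dft (ds t); rewrite mulrC.
- by rewrite mulr0 f10.
Unshelve. all: by end_near. Qed.

(** If [c < 0], the derivative is negative for small positive [t], and by the mean
    value theorem [f] takes values below [f 0]. *)
Lemma jet2_min f b c : jet2 f b c ->
  (\forall t \near (0 : R), f 0 <= f t) -> b = 0 /\ 0 <= c.
Proof.
move=> [f1 [df f10 df1]] fmin.
have : \forall t \near (0 : R), is_derive (t : R) 1 f (f1 t) /\ f 0 <= f t.
  by apply: filterS2 df fmin => t.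
move=> /nbhs_ballP[d /= d0 dP].
have inb t : t \in `]- d, d[ -> ball (0 : R) d t.
  by rewrite in_itv /= => td; rewrite -ball_normE /= sub0r normrN ltr_norml.
have b0 : f1 0 = 0.
  have d00 : 0 \in `]- d, d[ by rewrite in_itv /= d0 oppr_lt0 d0.
  have dd : - d < d by rewrite gt0_cp.
  have dfd t : t \in `]- d, d[ -> derivable f t 1.
    by move=> /inb /dP[[]].
  have fm t : t \in `]- d, d[ -> f 0 <= f t by move=> /inb /dP[].
  have [_ e0] := derive1_at_min (ltW dd) dfd d00 fm.
  by have [[_ <-] _] := dP 0 (inb 0 d00).
split; first by rewrite -f10.
rewrite leNgt; apply/negP => c0.
have c20 : 0 < - c / 2 by rewrite divr_gt0 // oppr_gt0.
have df10 : differentiable f1 0 by apply/derivable1_diffP; case: df1.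
have := differentiable_bound df10 c20 => /nbhs_ballP[d' /= d'0 d'P].
pose s := Num.min d d' / 2.
have m0 : 0 < Num.min d d' by rewrite lt_min d0.
have s0 : 0 < s by rewrite divr_gt0.
have sm : s < Num.min d d' by rewrite /s ltr_pdivrMr // ltr_pMr // ltr1n.
move: sm; rewrite lt_min => /andP[sd sd'].
have bs t : 0 <= t <= s -> ball (0 : R) d t.
  move=> /andP[t0 ts]; rewrite -ball_normE /= sub0r normrN ger0_norm //.
  exact: le_lt_trans ts sd.
have [||t] := @MVT R f f1 0 s s0.
- move=> t; rewrite in_itv /= => /andP[t0 ts].
  by have [] := dP t (bs t (introT andP (conj (ltW t0) (ltW ts)))).
- apply: derivable_within_continuous => t; rewrite in_itv /= => ts.
  by have [[]] := dP t (bs t ts).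
rewrite in_itv /= subr0 => /andP[t0 ts] fE.
have ft : f1 t < 0.
  have bt : ball (0 : R) d' t.
    by rewrite -ball_normE /= sub0r normrN gtr0_norm // (lt_trans ts).
  have := d'P t bt; rewrite addr0 b0 subr0.
  have -> : 'd f1 (0 : R) t = t * c.
    have [_ <-] := df1; rewrite deriveE //.
    by rewrite -[in LHS](mulr1 t) -[t * 1]/(t *: 1) linearZ.
  rewrite (gtr0_norm t0) => H.
  have := le_trans (ler_norm _) H; rewrite lerBlDl => /le_lt_trans; apply.
  by have : t * c < 0; [rewrite pmulr_rlt0|lra].
have [_] := dP s (bs s (introT andP (conj (ltW s0) (lexx s)))).
by rewrite -subr_ge0 fE leNgt pmulr_llt0 // ft.
Qed.

(** Both [f] and [- f] have a minimum at [0]. *)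
Lemma jet2_const f b c : jet2 f b c -> (forall t, f t = f 0) -> b = 0 /\ c = 0.
Proof.
move=> jf f0.
have [|b0 c0] := jet2_min jf; first by near=> t; rewrite f0.
have [|_ c0'] := @jet2_min (fun t => -1 * f t) _ _ (jet2M (jet2_cst (-1)) jf).
  by near=> t; rewrite f0.
split=> //; apply/eqP; rewrite eq_le c0 andbT.
by move: c0'; rewrite b0 !mul0r mulr0 !add0r mulN1r oppr_ge0.
Unshelve. all: by end_near. Qed.

End Jets.

(** * Invariant forms of a compact group *)

Lemma continuous_sum (R : realType) (T : topologicalType) n (f : 'I_n -> T -> R) :
  (forall i, continuous (f i)) -> continuous (fun x => \sum_i f i x).
Proof.
by move=> cf x; apply: (@cvg_big _ _ _ _ _ (@add_continuous R^o)) => i _; exact: cf.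
Qed.

(** When [x'] is close to [x], the values [H (t, x')] and [H (t, x)] are close
    uniformly in [t] by compactness, hence so are their maxima. *)
Lemma compact_sup_continuous (R : realType) (T X : topologicalType)
    (t0 : T) (H : (T * X)%type -> R) : compact [set: T] -> continuous H ->
  exists N : X -> R, [/\ continuous N, forall t x, H (t, x) <= N x &
    forall x, exists t, N x = H (t, x)].
Proof.
move=> cT cH.
have cHx x : continuous (fun t => H (t, x)).
  move=> t; apply: (cvg_comp (fun t => (t, x)) H); last exact: cH.
  exact: (@cvg_pair _ _ _ (nbhs t) (nbhs t) (nbhs x) _ _ _ id (cst x) cvg_id (cvg_cst _)).
have /choice[s sP] x : exists t, forall t', H (t', x) <= H (t, x).
  have T0 : [set: T] !=set0 by exists t0.
  have cw : {within [set: T], continuous (fun t => H (t, x))}.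
    exact: continuous_subspaceT.
  have [c _ cP] := compact_EVT_max T0 cT cw.
  by exists c => t'; apply: cP; rewrite inE.
exists (fun x => H (s x, x)); split=> [x|t x|x]; [|exact: sP|by exists (s x)].
apply/cvgrPdist_le => eps eps0.
have /compact_near_coveringP K := cT.
have near_t (t : T) : \forall t' \near t & x' \near nbhs x,
    `|H (t', x) - H (t', x')| <= eps.
  have h1 : (fun p : T * X => p.1) @ nbhs (t, x) --> nbhs t by exact: cvg_fst.
  have h3 : (fun p : T * X => x) @ nbhs (t, x) --> nbhs x by exact: cvg_cst.
  have FF : Filter (nbhs (t, x)) by exact: nbhs_filter.
  have Ft : Filter (nbhs t) by exact: nbhs_filter.
  have Fx : Filter (nbhs x) by exact: nbhs_filter.
  have c1 := cvg_comp _ _ (@cvg_pair _ _ _ _ _ _ FF Ft Fx _ _ h1 h3) (cH (t, x)).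
  have := cvgB c1 (cH (t, x)); rewrite subrr => /(_ FF) /cvgrPdist_le /(_ _ eps0).
  by apply: filterS => -[t' h] /=; rewrite sub0r normrN.
have := K X (nbhs x) (fun x' t => `|H (t, x) - H (t, x')| <= eps) _ (fun t _ => near_t t).
have FX : Filter (nbhs x) by exact: nbhs_filter.
move=> /(_ FX); apply: filterS => x' Hx'.
have d t : `|H (t, x) - H (t, x')| <= eps by exact: Hx'.
rewrite ler_norml; apply/andP; split.
  have := le_trans (ler_norm _) (le_trans (eq_ind _ (fun z => z <= eps) (d (s x')) _ (distrC _ _)) (lexx _)).
  by have := sP x (s x'); lra.
by have := le_trans (ler_norm _) (d (s x)); have := sP x' (s x); lra.
Qed.

Section TangentCurves.
Context (R : realType) (M : manifold R) (p : M) (v : (M -> R) -> R).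
Context (tv : tangent p v).

(** A straight line in a chart, in the direction of the vector that represents
    [v]. *)
Lemma tangent_jet : exists gamma : R -> M, gamma 0 = p /\
  forall f : M -> R, smooth_fun f -> exists c, jet2 (f \o gamma) (v f) c.
Proof.
have tM := manifold_tame M.
have [c hc cp] := tame_cover tM p; have tc := tame_chart tM hc.
have [w wE] := tangent_chart tv hc cp.
set x0 := cmap c p in wE.
exists (fun t => cinv c (x0 + t *: w)); split.
  by rewrite scale0r addr0 cmapK.
move=> f sf.
have sfc := proj1 (smooth_funP f tM) sf c hc.
have cx0 : ccod c x0 by exact: cmap_cod.
have [df Df] := sfc 2; have [dDf _] := Df w.
have dl (h : ch_model M -> R^o) (t : R) : (differentiable h (x0 + t *: w)) ->
    is_derive t 1 (fun t : R => h (x0 + t *: w)) ('D_w h (x0 + t *: w)).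
  by move=> dh; apply: is_derive_line; exact: diff_derivable.
pose f1 (t : R) : R^o := 'D_w (f \o cinv c : _ -> R^o) (x0 + t *: w).
exists ('D_w ('D_w (f \o cinv c : _ -> R^o)) x0), f1; split.
- have cl : (fun t : R => x0 + t *: w) @ (0 : R) --> x0.
    rewrite -[X in _ --> X]addr0 -[X in _ --> _ + X](scale0r w).
    by apply: cvgD; [exact: cvg_cst|apply: cvgZr_tmp; exact: cvg_id].
  have nc : nbhs x0 (ccod c).
    by apply: open_nbhs_nbhs; split => //; exact: ccod_open.
  have H : \forall t \near (0 : R), ccod c (x0 + t *: w) by exact: (cl _ nc).
  by near=> t; apply: dl; apply: df; near: t.
- by rewrite wE // /f1 scale0r addr0.
- have := dl ('D_w (f \o cinv c : _ -> R^o)) 0.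
  by rewrite scale0r addr0 => /(_ (dDf _ cx0)).
Unshelve. all: by end_near. Qed.

End TangentCurves.

Section CompactGroup.
Context (R : realType) (G : lie_group R) (g : lie_algebra G).
Implicit Types (x y z u : g) (a b : G).
Let tG := manifold_tame G.
Local Notation "\[ x , y \]" := (la_bracket x y) (at level 0).
Let n := \dim {:g}.
Let bs := vbasis {:g}.

Section Forms.
Context (B : g -> g -> R) (bB : bilinear_form B).

Lemma smooth_Ad_form x z : smooth_fun (fun a => B (Ad a x) z).
Proof.
have lin : linear (fun x => B x z : R^o) by move=> k u w; exact: bB.1.
pose l : {linear g -> R^o} := HB.pack (fun x => B x z : R^o)
  (GRing.isLinear.Build R g R^o _ _ lin).
exact: (smooth_Ad l).
Qed.

Lemma derive_Ad_form x y z :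
  la_tangent x (fun a => B (Ad a y) z) = B \[x, y\] z.
Proof.
have lin : linear (fun x => B x z : R^o) by move=> k u w; exact: bB.1.
pose l : {linear g -> R^o} := HB.pack (fun x => B x z : R^o)
  (GRing.isLinear.Build R g R^o _ _ lin).
exact: (derive_Ad l).
Qed.

(** An [Ad]-invariant form is [ad]-invariant: differentiate at the identity. *)
Lemma invariant_skew : (forall a x y, B (Ad a x) (Ad a y) = B x y) ->
  forall x y z, B \[x, y\] z = - B y \[x, z\].
Proof.
move=> invB x y z; apply/eqP; rewrite -subr_eq0 opprK; apply/eqP.
have sc i (w : g) : smooth_fun (fun a => coord bs i (Ad a w)) := smooth_Ad (coord bs i) w.
have E : (fun a => B y z) = (fun a => \sum_(i < n) coord bs i (Ad a z) * B (Ad a y) bs`_i).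
  apply/funext => a; rewrite -(invB a) {1}(coord_vbasisE (Ad a z)) bform_sumr //.
have s i : smooth_fun (fun a => coord bs i (Ad a z) * B (Ad a y) bs`_i).
  by apply: smooth_funM => //; exact: smooth_Ad_form.
have := tangent_cst tG (la_tangentP x) (B y z); rewrite E.
have [_ ->] := tangent_sum tG (la_tangentP x) s.
have D (i : 'I_n) : la_tangent x (fun a => coord bs i (Ad a z) * B (Ad a y) bs`_i)
    = coord bs i \[x, z\] * B y bs`_i + coord bs i z * B \[x, y\] bs`_i.
  rewrite (tangent_leibniz (la_tangentP x) (sc i z) (smooth_Ad_form _ _)).
  by rewrite (derive_Ad (coord bs i)) derive_Ad_form !Ad1.
rewrite (eq_bigr _ (fun i _ => D i)) big_split /= => <-.
rewrite addrC {1}(coord_vbasisE \[x, z\]) {1}[in B \[x, y\] _](coord_vbasisE z).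
rewrite !(bform_sumr bB).
reflexivity.
Qed.

End Forms.

Section InvariantForm.
Hypothesis cG : compact [set: G].
Local Notation e := (lg_one G).

Let q x := \sum_(i < n) coord bs i x ^+ 2.

Let q_gt0 x : x != 0 -> 0 < q x.
Proof.
move=> x0; have q0 : 0 <= q x by apply: sumr_ge0 => i _; exact: sqr_ge0.
rewrite lt_neqAle q0 andbT eq_sym; apply: contra x0 => /eqP.
move=> /psumr_eq0P H; rewrite (coord_vbasisE x) big1 // => i _.
have /eqP := H (fun i _ => sqr_ge0 _) i isT.
by rewrite sqrf_eq0 => /eqP ->; rewrite scale0r.
Qed.

Let cAd i x : continuous (fun a => coord bs i (Ad a x) : R).
Proof. exact: smooth_map_continuous (smooth_Ad (coord bs i) x). Qed.

Let min_orbit : exists m : g -> R, (forall a x, m x <= q (Ad a x)) /\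
  forall x, exists a, m x = q (Ad a x).
Proof.
have /choice[s sP] x : exists a : G, forall b, q (Ad a x) <= q (Ad b x).
  have cq : continuous (fun a => q (Ad a x)).
    apply: continuous_sum => i a; apply: continuousM; exact: cAd.
  have T0 : [set: G] !=set0 by exists e.
  have cw : {within [set: G], continuous (fun a => q (Ad a x))}.
    exact: continuous_subspaceT.
  have [c _ cP] := compact_EVT_min T0 cG cw.
  by exists c => b; apply: cP; rewrite inE.
by exists (fun x => q (Ad (s x) x)); split=> [a x|x]; [exact: sP|exists (s x)].
Qed.

(** Forms are encoded by vectors of coefficients, a space in which closed bounded
    sets are compact. *)
Let frm (S : 'rV[R]_(n * n)) x y :=
  \sum_(i < n) \sum_(j < n) S 0 (mxvec_index i j) * (coord bs i x * coord bs j y).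

Let frm_bilinear S : bilinear_form (frm S).
Proof.
split=> k x y z; rewrite /frm mulr_sumr -big_split; apply: eq_bigr => i _ /=;
  rewrite mulr_sumr -big_split; apply: eq_bigr => j _ /=;
  rewrite linearP /=; ring.
Qed.

Let frm_mx (A : 'M[R]_n) (i j : 'I_n) : frm (mxvec A) bs`_i bs`_j = A i j.
Proof.
rewrite /frm (bigD1 i) //= [X in _ + X]big1 => [|k ki]; last first.
  by rewrite big1 // => l _; rewrite coord_free ?(basis_free (vbasisP _)) //
    eq_sym (negPf ki) mul0r mulr0.
rewrite (bigD1 j) //= [X in _ + X + _]big1 => [|l lj]; last first.
  by rewrite [coord bs l _]coord_free ?(basis_free (vbasisP _)) //
    eq_sym (negPf lj) !mulr0.
by rewrite !coord_free ?(basis_free (vbasisP _)) // !eqxx !mulr1 !addr0 mxvecE.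
Qed.

Let form_eq (B B' : g -> g -> R) : bilinear_form B -> bilinear_form B' ->
  (forall i j : 'I_n, B bs`_i bs`_j = B' bs`_i bs`_j) -> forall x y, B x y = B' x y.
Proof.
move=> bB bB' E x y; rewrite (coord_vbasisE x) (coord_vbasisE y) !bform_suml //.
apply: eq_bigr => i _; rewrite (bform_sumr bB) (bform_sumr bB'); f_equal.
by apply: eq_bigr => j _; rewrite E.
Qed.

(** A convex minimisation replaces the average over the group. Consider the
    symmetric forms [S] for which [S x x] is at least the minimum of [q] on the
    orbit of [x]: they are positive definite, and form a closed convex set that
    is invariant under the group. On it, minimise the largest Euclidean norm
    of the coefficients of [S] over the group orbit of [S]. This function is
    invariant, and by the parallelogram identity its minimiser is unique,
    hence invariant. *)
Lemma compact_invariant_form : exists B : g -> g -> R, inner_product B /\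
  forall a x y, B (Ad a x) (Ad a y) = B x y.
Proof.
have [m [mle mE]] := min_orbit.
pose H (p : G * 'rV[R]_(n * n)) : R := \sum_(i < n) \sum_(j < n)
  frm p.2 (Ad p.1 bs`_i) (Ad p.1 bs`_j) ^+ 2.
have cfrm (i j : 'I_n) : continuous (fun p : G * 'rV[R]_(n * n) =>
    frm p.2 (Ad p.1 bs`_i) (Ad p.1 bs`_j) : R).
  have cc k (i' : 'I_n) : continuous (fun p : G * 'rV[R]_(n * n) =>
      coord bs k (Ad p.1 bs`_i') : R).
    by move=> p; apply: (cvg_comp fst (fun a => coord bs k (Ad a bs`_i') : R));
      [exact: cvg_fst|exact: cAd].
  apply: continuous_sum => k; apply: continuous_sum => l p; apply: cvgM.
    apply: (cvg_comp snd (fun S : 'rV[R]_(n * n) => S 0 _)); first exact: cvg_snd.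
    exact: coord_continuous.
  by apply: cvgM; exact: cc.
have cH : continuous H.
  by apply: continuous_sum => i; apply: continuous_sum => j p; apply: cvgM; exact: cfrm.
have [N [cN HN NH]] := compact_sup_continuous e cG cH.
pose Q : set 'rV[R]_(n * n) := [set S |
  (forall x y, frm S x y = frm S y x) /\ forall x, m x <= frm S x x].
pose S0 : 'rV[R]_(n * n) := mxvec 1%:M.
have S0E x y : frm S0 x y = \sum_(i < n) coord bs i x * coord bs i y.
  apply: eq_bigr => i _; rewrite (bigD1 i) //= big1 ?addr0 => [|j ji].
    by rewrite mxvecE mxE eqxx mul1r.
  by rewrite mxvecE mxE eq_sym (negPf ji) mul0r.
have QS0 : Q S0.
  split=> [x y|x]; first by rewrite !S0E; apply: eq_bigr => i _; rewrite mulrC.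
  by rewrite S0E; have := mle e x; rewrite Ad1.
have cfx x y : continuous (fun S => frm S x y : R).
  apply: continuous_sum => i; apply: continuous_sum => j S; apply: cvgMr_tmp.
    exact: (nbhs_filter S).
  exact: coord_continuous.
have [S1 [QS1 S1min]] : exists S1, Q S1 /\ forall S, Q S -> N S1 <= N S.
  pose Q' := Q `&` [set S | N S <= N S0].
  have clQ : closed Q.
    have -> : Q = (\bigcap_(p in [set: g * g])
        ((fun S => frm S p.1 p.2 - frm S p.2 p.1) @^-1` [set r : R | r = 0])) `&`
      \bigcap_(x in [set: g]) ((fun S => frm S x x) @^-1` [set r : R | m x <= r]).
      apply/seteqP; split=> S /=.
        move=> [sS mS]; split=> [p _ /=|x _ /=]; last exact: mS.
        by rewrite sS subrr.
      move=> [sS mS]; split=> [x y|x]; last exact: mS.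
      by have /eqP := sS (x, y) I; rewrite subr_eq0 => /eqP.
    apply: closedI; apply: closed_bigI => p _; apply: preimage_closed.
    - by move=> S _; apply: continuousB; exact: cfx.
    - exact: closed_eq.
    - by move=> S _; exact: cfx.
    - exact: closed_ge.
  have cQ' : compact Q'.
    apply: bounded_closed_compact.
      exists (N S0 + 1); split; first exact: num_real.
      move=> r Nr S [_ /= SN]; rewrite [leLHS]/Num.norm /= mx_normrE.
      have N0 : 0 <= N S0.
        by apply: le_trans (HN e S0); do 2 apply: sumr_ge0 => ? _; exact: sqr_ge0.
      apply/bigmax_leP; split=> [|[i0 k] _ /=]; first by apply: ltW; lra.
      rewrite (ord1 i0); case/mxvec_indexP: k => i j.
      have : S 0 (mxvec_index i j) ^+ 2 <= N S0.
        apply: le_trans SN; apply: le_trans (HN e S).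
        rewrite /H (bigD1 i) //= (bigD1 j) //= !Ad1.
        have -> : frm S bs`_i bs`_j = S 0 (mxvec_index i j).
          by rewrite -[in LHS](vec_mxK S) frm_mx mxE.
        rewrite -addrA lerDl addr_ge0 //.
          by apply: sumr_ge0 => ? _; exact: sqr_ge0.
        by do 2 apply: sumr_ge0 => ? _; exact: sqr_ge0.
      set s := S 0 _; move=> sN.
      have : `|s| ^+ 2 <= N S0 by rewrite real_normK ?num_real.
      have := normr_ge0 s; have : (N S0 + 1) ^+ 2 >= N S0 by nra.
      by nra.
    apply: closedI => //.
    by apply: (@preimage_closed _ _ N [set r | r <= N S0]); [move=> S _; exact: cN|exact: closed_le].
  have Q0 : Q' !=set0 by exists S0; split=> //=.
  have cw : {within Q', continuous N} by exact: continuous_subspaceT.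
  have [S1] := compact_EVT_min Q0 cQ' cw; rewrite inE => -[QS1 NS1] S1min.
  exists S1; split=> // S QS; have [NS|NS] := leP (N S) (N S0).
    by apply: S1min; rewrite inE; split.
  exact: le_trans NS1 (ltW NS).
have uniq S : Q S -> N S <= N S1 -> forall x y, frm S x y = frm S1 x y.
  move=> QS NS; pose T := 2^-1 *: (S + S1).
  have TE x y : frm T x y = 2^-1 * (frm S x y + frm S1 x y).
    rewrite /frm -big_split mulr_sumr; apply: eq_bigr => i _ /=.
    rewrite -big_split mulr_sumr; apply: eq_bigr => j _ /=.
    by rewrite !mxE; ring.
  have QT : Q T.
    split=> [x y|x]; rewrite !TE.
      by rewrite QS.1 QS1.1.
    by have := QS.2 x; have := QS1.2 x; lra.
  have [a Na] := NH T.
  pose d (i j : 'I_n) := 2^-1 * (frm S (Ad a bs`_i) (Ad a bs`_j) - frm S1 (Ad a bs`_i) (Ad a bs`_j)).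
  have HT : H (a, T) = 2^-1 * (H (a, S) + H (a, S1)) -
      \sum_(i < n) \sum_(j < n) d i j ^+ 2.
    rewrite /H -big_split mulr_sumr -sumrB; apply: eq_bigr => i _ /=.
    rewrite -big_split mulr_sumr -sumrB; apply: eq_bigr => j _ /=.
    by rewrite TE /d; field.
  have d0 : \sum_(i < n) \sum_(j < n) d i j ^+ 2 = 0.
    apply/eqP; rewrite eq_le; apply/andP; split; last first.
      by do 2 apply: sumr_ge0 => ? _; exact: sqr_ge0.
    have := S1min T QT; rewrite Na HT.
    have := HN a S; have := HN a S1; lra.
  have dij (i j : 'I_n) : frm S (Ad a bs`_i) (Ad a bs`_j) = frm S1 (Ad a bs`_i) (Ad a bs`_j).
    move/psumr_eq0P : d0 => /(_ (fun i _ => sumr_ge0 _ (fun j _ => sqr_ge0 _))).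
    move=> /(_ i isT) di0; have := psumr_eq0P (fun j _ => sqr_ge0 (d i j)) di0.
    move=> /(_ j isT) /eqP.
    by rewrite sqrf_eq0 mulf_eq0 invr_eq0 pnatr_eq0 /= subr_eq0 => /eqP.
  have bAd (S' : 'rV[R]_(n * n)) : bilinear_form (fun x y => frm S' (Ad a x) (Ad a y)).
    by split=> k x y z; rewrite linearP (frm_bilinear S').1 || rewrite linearP (frm_bilinear S').2.
  move=> x y; rewrite -(AdKV a x) -(AdKV a y).
  exact: (form_eq (bAd S) (bAd S1) dij).
have inv a x y : frm S1 (Ad a x) (Ad a y) = frm S1 x y.
  pose T : 'rV[R]_(n * n) := mxvec (\matrix_(i, j) frm S1 (Ad a bs`_i) (Ad a bs`_j)).
  have bAd : bilinear_form (fun x y => frm S1 (Ad a x) (Ad a y)).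
    by split=> k x' y' z; rewrite linearP; [exact: (frm_bilinear S1).1|exact: (frm_bilinear S1).2].
  have TE x' y' : frm T x' y' = frm S1 (Ad a x') (Ad a y').
    apply: (form_eq (frm_bilinear T) bAd) => i j.
    by rewrite frm_mx mxE.
  rewrite -TE; apply: uniq.
    split=> [x' y'|x']; rewrite !TE; first exact: QS1.1.
    apply: le_trans (QS1.2 _); have [b ->] := mE (Ad a x').
    by rewrite -AdM.
  have [b ->] := NH T; apply: le_trans (HN (lg_mul a b) S1).
  by rewrite /H; apply: ler_sum => i _; apply: ler_sum => j _; rewrite /= TE !AdM.
exists (frm S1); split=> //; split=> //; first exact: QS1.1.
move=> x x0; apply: lt_le_trans (QS1.2 x); have [a ->] := mE x.
apply: q_gt0; apply: contra x0 => /eqP ax0.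
by rewrite -(AdK a x) ax0 linear0.
Qed.

End InvariantForm.

Section Killing.
Hypothesis cG : compact [set: G].
Hypothesis sg : semisimple g.
Local Notation e := (lg_one G).

Lemma killingE (B : g -> g -> R) k (f : 'I_k -> g) x y : inner_product B ->
  orthonormal_family B f -> (forall z, z = \sum_i B z (f i) *: f i) ->
  killing x y = \sum_i B \[x, \[y, f i\]\] (f i).
Proof.
move=> iB of_ fE.
exact: (trace_orthonormal (la_bracket x \o la_bracket y) iB of_ fE).
Qed.

(** The trace does not depend on the orthonormal basis, and [Ad] maps
    orthonormal bases to orthonormal bases. *)
Lemma inner_Ad a x y : inner (Ad a x) (Ad a y) = inner x y.
Proof.
have [B [iB invB]] := compact_invariant_form cG.
have [k [f [of_ fE]]] := orthonormal_basis iB.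
pose f' i := Ad (lg_inv a) (f i).
have of' : orthonormal_family B f' by move=> i j; rewrite /f' invB of_.
have fE' z : z = \sum_i B z (f' i) *: f' i.
  apply: (can_inj (AdK a)); rewrite linear_sum {1}(fE (Ad a z)).
  apply: eq_bigr => i _; rewrite linearZ /= /f' AdKV; congr (_ *: _).
  by rewrite -{1}[f i](AdKV a) invB.
rewrite /inner; congr (- _).
rewrite (killingE _ _ iB of_ fE) (killingE _ _ iB of' fE').
by apply: eq_bigr => i _; rewrite -[f i](AdKV a) -!Ad_bracket invB.
Qed.

(** For an invariant inner product [B], [ad x] is skew and [inner x x] is the
    squared [B]-norm of [ad x]. If it is zero, [x] is central and spans an abelian
    ideal. *)
Lemma inner_product_inner : inner_product (@inner R G g).
Proof.
have [B [iB invB]] := compact_invariant_form cG.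
have [k [f [of_ fE]]] := orthonormal_basis iB.
have [bB sB pB] := iB.
have skB := invariant_skew bB invB.
have innerE x y : inner x y = \sum_i B \[x, f i\] \[y, f i\].
  rewrite /inner (killingE _ _ iB of_ fE) -sumrN; apply: eq_bigr => i _.
  by rewrite skB opprK sB.
split.
- split=> r x y z; rewrite !innerE mulr_sumr -big_split; apply: eq_bigr => i _ /=.
    by rewrite bracketDl bracketZl bB.1.
  by rewrite bracketDl bracketZl bB.2.
- by move=> x y; rewrite !innerE; apply: eq_bigr => i _; rewrite sB.
move=> x x0.
have B0 z : 0 <= B z z.
  by have [->|/pB/ltW//] := eqVneq z 0; rewrite bform0l.
have i0 : 0 <= inner x x by rewrite innerE; apply: sumr_ge0.
rewrite lt_neqAle i0 andbT eq_sym; apply: contra x0 => /eqP; rewrite innerE.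
move=> /psumr_eq0P H.
have xf i : \[x, f i\] = 0.
  apply/eqP/negPn/negP => /pB.
  by rewrite (H (fun i _ => B0 _) i isT) ltxx.
have xz z : \[x, z\] = 0.
  rewrite (fE z) linear_sum big1 // => i _.
  by rewrite linearZ /= xf scaler0.
suff V0 : <[x]>%VS = 0%VS by rewrite -memv0 -V0 memv_line.
apply: sg.
  move=> u v /vlineP[r ->]; rewrite linearZ /= bracketC xz oppr0 scaler0.
  exact: mem0v.
by move=> u v /vlineP[r ->] _; rewrite bracketZl xz scaler0.
Qed.

Let iI := inner_product_inner.
Let bI : bilinear_form (@inner R G g). Proof. by case: iI. Qed.
Let sI : forall x y : g, inner x y = inner y x. Proof. by case: iI. Qed.

Lemma inner_skew x y z : inner \[x, y\] z = - inner y \[x, z\].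
Proof. exact: (invariant_skew bI inner_Ad). Qed.

Lemma inner_eq0 x : (forall z, inner x z = 0) -> x = 0.
Proof.
move=> x0; apply/eqP/negPn/negP; have [_ _ pI] := iI.
by move=> /pI; rewrite x0 ltxx.
Qed.

(** * Adjoint orbits and abelian subalgebras *)

(** The first-order and second-order conditions for the sum of the squares of
    the [inner (Ad (k t) y) (c i)], where [k t] is
    [gamma(t/2) gamma(-t/2)^-1] for a curve [gamma] with velocity [x] at the
    identity. The operators [Ad (gamma t)] are orthogonal, and for such a
    curve of operators this symmetrised product has second derivative
    [(ad x)^2] at [0], whatever the second derivative of [gamma]. *)
Lemma orbit_min_conditions r (c : 'I_r -> g) y :
  (forall a, \sum_i inner y (c i) ^+ 2 <= \sum_i inner (Ad a y) (c i) ^+ 2) ->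
  let h := \sum_i inner y (c i) *: c i in
  forall x, inner \[x, y\] h = 0 /\
    inner \[x, y\] \[x, h\] <= \sum_i inner \[x, y\] (c i) ^+ 2.
Proof.
move=> ymin h x.
have [k [f [of_ fE]]] := orthonormal_basis iI.
have [gamma [g0 gj]] := tangent_jet (la_tangentP x).
have /choice[J JP] p : exists cc : g -> R, forall q, 
    jet2 (fun t => inner (Ad (gamma t) p) q) (inner \[x, p\] q) (cc q).
  have H q : exists cc, jet2 (fun t => inner (Ad (gamma t) p) q) (inner \[x, p\] q) cc.
    have [cc ccP] := gj _ (smooth_Ad_form bI p q).
    by exists cc; rewrite -(derive_Ad_form bI).
  by have /choice[cc ccP] := H; exists cc.
have g0E p q : inner (Ad (gamma 0) p) q = inner p q by rewrite g0 Ad1.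
have adj a (p q : g) : inner (Ad a p) q = inner p (Ad (lg_inv a) q).
  by rewrite -{1}[q](AdKV a) inner_Ad.
pose rho i (t : R) : R := \sum_j
  inner (Ad (gamma (- 2^-1 * t)) (f j)) y * inner (Ad (gamma (2^-1 * t)) (f j)) (c i).
have rhoE i t : rho i t = inner (Ad (lg_mul (gamma (2^-1 * t)) (lg_inv (gamma (- 2^-1 * t)))) y) (c i).
  rewrite AdM adj (orthonormal_form _ _ iI fE); apply: eq_bigr => j _.
  by rewrite !adj.
have par p q : \sum_j inner \[x, f j\] p * inner (f j) q = - inner \[x, p\] q.
  rewrite (orthonormal_form _ _ iI fE) -sumrN; apply: eq_bigr => j _.
  by rewrite inner_skew mulNr.
pose S i := inner \[x, y\] \[x, c i\].
have SE i : \sum_j inner \[x, f j\] y * inner \[x, f j\] (c i) = S i.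
  rewrite /S (orthonormal_form _ _ iI fE); apply: eq_bigr => j _.
  by rewrite !inner_skew mulrNN.
pose K i := \sum_j (J (f j) y * inner (f j) (c i) + inner (f j) y * J (f j) (c i)).
(* orthogonality makes [F] below constant, which determines the combination [K] of
   the second derivatives [J] *)
have KE i : K i = - (2 * S i).
  pose F t := \sum_j inner (Ad (gamma t) (f j)) y * inner (Ad (gamma t) (f j)) (c i).
  have FE t : F t = inner y (c i).
    rewrite -(inner_Ad (lg_inv (gamma t))) (orthonormal_form _ _ iI fE).
    by apply: eq_bigr => j _; rewrite !adj.
  have jF := jet2_sum (fun j => jet2M (JP (f j) y) (JP (f j) (c i))).
  have [|_ /eqP] := jet2_const jF; first by move=> t; rewrite -!/(F _) !FE.
  under eq_bigr do rewrite !g0E -addrA [2 * _ + _]addrC addrA.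
  rewrite big_split /= -/(K i) -mulr_sumr SE.
  by rewrite addr_eq0 => /eqP.
have jrho i : jet2 (rho i) (inner \[x, y\] (c i)) (- S i).
  have jj j := jet2M (jet2_scale (- 2^-1) (JP (f j) y)) (jet2_scale 2^-1 (JP (f j) (c i))).
  have := jet2_sum jj; rewrite -/(rho i).
  under eq_bigr do rewrite !mulr0 !g0E.
  under [X in jet2 _ _ X]eq_bigr do rewrite !mulr0 !g0E.
  rewrite big_split /=; under eq_bigr do rewrite -mulrA.
  under [X in _ + X]eq_bigr do rewrite mulrCA [inner (f _) y * _]mulrC.
  rewrite -!mulr_sumr !par.
  have -> : \sum_i0 ((- 2^-1) ^+ 2 * J (f i0) y * inner (f i0) (c i) +
      2 * (- 2^-1 * inner \[x, f i0\] y * (2^-1 * inner \[x, f i0\] (c i))) +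
      inner (f i0) y * (2^-1 ^+ 2 * J (f i0) (c i))) = - S i.
    transitivity (2^-1 ^+ 2 * K i - 2^-1 * S i).
      rewrite /K -SE !mulr_sumr -sumrB; apply: eq_bigr => j _.
      by field.
    by rewrite KE; field.
  rewrite [inner \[x, c i\] y]inner_skew (sI (c i)) (opprK (inner _ _)).
  by congr (jet2 _ _ _); field.
pose phi t : R := \sum_i rho i t * rho i t.
have jphi := jet2_sum (fun i => jet2M (jrho i) (jrho i)).
have rho0 i : rho i 0 = inner y (c i).
  by rewrite rhoE !mulr0 g0 lg_mulVr Ad1.
have [|] := jet2_min jphi.
  near=> t; rewrite -!/(phi _) /phi.
  under eq_bigr do rewrite rho0 -expr2; under [leRHS]eq_bigr do rewrite rhoE -expr2.
  exact: ymin.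
under eq_bigr do rewrite rho0 [_ * inner y _]mulrC -mulr2n -mulr_natl.
rewrite -mulr_sumr -bform_sumr // -/h => /eqP.
rewrite mulf_eq0 pnatr_eq0 /= => /eqP h0.
under eq_bigr do rewrite rho0.
move=> H; split=> //.
have hS : inner \[x, y\] \[x, h\] = \sum_i inner y (c i) * S i.
  rewrite /h linear_sum; under eq_bigr do rewrite linearZ /=.
  by rewrite bform_sumr.
suff : 0 <= 2 * (\sum_i inner \[x, y\] (c i) ^+ 2 - inner \[x, y\] \[x, h\]).
  by rewrite pmulr_rge0 // subr_ge0.
apply: le_trans H _; rewrite hS -sumrB mulr_sumr le_eqVlt; apply/orP; left; apply/eqP.
by apply: eq_bigr => i _; ring.
Unshelve. all: by end_near. Qed.

(** At the minimum, [h] and [y] commute, hence so do [ad h] and [ad y]. The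
    second-order condition makes [ad h ad y] nonnegative on the image of [ad h],
    hence everywhere because it vanishes on the orthogonal complement. So its
    trace [- inner h y] is nonnegative, while [inner h y] is the sum of the squares
    of the [inner y (c i)]. *)
Lemma orbit_min_orthogonal (C : {vspace g}) r (c : 'I_r -> g) y :
  abelian_sub C -> (forall i, c i \in C) ->
  (forall a, \sum_i inner y (c i) ^+ 2 <= \sum_i inner (Ad a y) (c i) ^+ 2) ->
  forall i, inner y (c i) = 0.
Proof.
move=> aC cC ymin; set h := \sum_i inner y (c i) *: c i.
have cond x := orbit_min_conditions ymin x; rewrite -/h /= in cond.
have hC : h \in C by apply: rpred_sum => i _; rewrite rpredZ.
have hy0 : \[h, y\] = 0.
  apply: inner_eq0 => z; have [zh _] := cond z.
  rewrite bracketC bformNl // inner_skew opprK.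
  by rewrite [X in inner _ X]bracketC bformNr // sI zh oppr0.
have hyC z : \[h, \[y, z\]\] = \[y, \[h, z\]\].
  by rewrite jacobi hy0 bracket0l add0r.
have key z : 0 <= inner \[h, \[y, \[h, z\]\]\] \[h, z\].
  have [_] := cond \[h, z\].
  rewrite [leRHS]big1 => [|i _]; last first.
    rewrite bracketC bformNl // inner_skew opprK inner_skew.
    rewrite hyC (aC h (c i)) // linear0 bform0r // oppr0.
    by rewrite expr0n.
  rewrite bracketC bformNl // [X in inner _ X]bracketC bformNr // opprK.
  by move=> H; rewrite inner_skew oppr_ge0.
have pos w : 0 <= inner \[h, \[y, w\]\] w.
  pose A := linfun (la_bracket h).
  have [k [f [of_ fA fE]]] := orthonormal_basis_sub (limg A) iI.
  pose w1 := \sum_i inner w (f i) *: f i.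
  have w1A : w1 \in limg A by apply: rpred_sum => i _; rewrite rpredZ.
  have [z _ zE] := memv_imgP w1A; rewrite lfunE /= in zE.
  have w0f i : inner (w - w1) (f i) = 0.
    rewrite bformDl // bformNl // /w1 bform_suml // (bigD1 i) //= of_ eqxx mulr1.
    by rewrite big1 ?addr0 ?subrr // => j ji; rewrite of_ (negPf ji) mulr0.
  have hw0 : \[h, w - w1\] = 0.
    apply: inner_eq0 => u; rewrite inner_skew.
    have uA : \[h, u\] \in limg A.
      by rewrite -[X in X \in _](lfunE (la_bracket h)) memv_img // memvf.
    rewrite (fE _ uA) bform_sumr // big1 ?oppr0 // => i _.
    by rewrite w0f mulr0.
  have wE : w = w1 + (w - w1) by rewrite addrC subrK.
  have hw : \[h, w\] = \[h, w1\] by apply/eqP; rewrite -subr_eq0 -linearB /= hw0.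
  rewrite hyC hw -hyC wE.
  rewrite bformDr // [X in _ + X]inner_skew hw0 bform0r // oppr0 addr0.
  by rewrite zE; exact: key.
have hyE : inner h y = \sum_i inner y (c i) ^+ 2.
  by rewrite sI /h bform_sumr //; apply: eq_bigr => i _; rewrite expr2.
have hy_le0 : inner h y <= 0.
  have [k [f [of_ fE]]] := orthonormal_basis iI.
  rewrite /inner (killingE _ _ iI of_ fE) oppr_le0.
  by apply: sumr_ge0 => i _; exact: pos.
have : \sum_i inner y (c i) ^+ 2 = 0.
  apply/eqP; rewrite eq_le -hyE hy_le0 hyE.
  by apply: sumr_ge0 => i _; exact: sqr_ge0.
move=> /psumr_eq0P H i; have /eqP := H (fun i _ => sqr_ge0 _) i isT.
by rewrite sqrf_eq0 => /eqP.
Qed.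

(** Over the compact group, minimise the sum of the squares of the inner products
    of [Ad a u] with a basis of [C]. *)
Theorem Ad_orbit_meets_orth (C : {vspace g}) u : abelian_sub C ->
  exists a : G, orth_compl C (Ad a u).
Proof.
move=> aC; pose c (i : 'I_(\dim C)) : g := (vbasis C)`_i.
have cC i : c i \in C by apply: vbasis_mem; rewrite mem_nth // size_tuple.
have cN : continuous (fun a => \sum_i inner (Ad a u) (c i) ^+ 2 : R).
  apply: continuous_sum => i; 
  exact: smooth_map_continuous (smooth_funM tG (smooth_Ad_form bI u (c i)) (smooth_Ad_form bI u (c i))).
have T0 : [set: G] !=set0 by exists e.
have cw : {within [set: G], continuous (fun a => \sum_i inner (Ad a u) (c i) ^+ 2 : R)}.
  exact: continuous_subspaceT.
have [a _ amin] := compact_EVT_min T0 cG cw.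
exists a => z zC.
have y0 : forall i, inner (Ad a u) (c i) = 0.
  apply: (orbit_min_orthogonal aC cC) => b.
  by rewrite -AdM; apply: amin; rewrite inE.
rewrite (coord_vbasis zC) bform_sumr // big1 // => i _.
by rewrite y0 mulr0.
Qed.

End Killing.

End CompactGroup.

(** * Invariance of fatness under the adjoint action *)

Section Bundle.
Context (R : realType) (G : lie_group R) (g : lie_algebra G).
Context (P : principal_bundle G) (theta : connection g P).
Implicit Types (X Y : (pb_total P -> R) -> (pb_total P -> R)) (a : G).
Implicit Types (p q : pb_total P) (f : pb_total P -> R).

Let tG := manifold_tame G.
Let tP := manifold_tame (pb_total P).
Let b := vbasis {:g}.

Local Notation "p '*r' a" := (@pb_act R G P p a) (at level 40, left associativity).
Local Notation "a '^g'" := (lg_inv a) (at level 2, format "a '^g'").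

Lemma pb_actK a p : p *r a *r a^g = p.
Proof. by rewrite -pb_actM lg_mulVr pb_act1. Qed.

Lemma pb_actKV a p : p *r a^g *r a = p.
Proof. by rewrite -pb_actM lg_mulV pb_act1. Qed.

Lemma smooth_pb_act a : @smooth_map R (pb_total P) (pb_total P) (fun p => p *r a).
Proof.
have tPG := tame_prod tP tG.
have sa : @smooth_map R (pb_total P) (charted_prod (pb_total P) G) (fun p => (p, a)).
  by apply: smooth_map_pair => //; [exact: smooth_map_id|exact: smooth_map_cst].
exact: smooth_map_comp tP tPG tP sa (@pb_act_smooth R G P).
Qed.

Lemma smooth_fun_pb_act a f : smooth_fun f -> smooth_fun (fun p => f (p *r a)).
Proof. exact: (smooth_fun_comp (g := fun p => p *r a)) (smooth_pb_act a). Qed.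

(** The push-forward of a vector field by right translation. *)
Definition translate_field a X : (pb_total P -> R) -> (pb_total P -> R) :=
  fun f p => X (fun q => f (q *r a)) (p *r a^g).

Lemma translate_field_at a X p :
  field_at (translate_field a X) (p *r a) =
  Defs.pushforward (fun q => q *r a : pb_total P) (field_at X p).
Proof. by apply/funext => f; rewrite /field_at /translate_field pb_actK. Qed.

Lemma vector_field_translate a X :
  @vector_field R (pb_total P) X -> @vector_field R (pb_total P) (translate_field a X).
Proof.
move=> vX; split=> [p|f sf].
  rewrite -(pb_actKV a p) translate_field_at.
  exact: tangent_pushforward (smooth_pb_act a) (field_tangent vX _).
apply: (smooth_fun_pb_act a^g); apply: field_smooth vX _ _.
exact: smooth_fun_pb_act.
Qed.

Lemma translate_fieldK a X : translate_field a (translate_field a^g X) = X.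
Proof.
apply/funext => f; apply/funext => p; rewrite /translate_field lg_invK pb_actKV.
by congr (X _ _); apply/funext => q; rewrite pb_actKV.
Qed.

Lemma translate_field_bracket a X Y :
  field_bracket (translate_field a X) (translate_field a Y) =
  translate_field a (@field_bracket R (pb_total P) X Y).
Proof.
have E Z f : (fun q => translate_field a Z f (q *r a)) = Z (fun q => f (q *r a)).
  by apply/funext => q; rewrite /translate_field pb_actK.
by apply/funext => f; apply/funext => p; rewrite /field_bracket {1 3}/translate_field !E.
Qed.

Lemma cn_on_translate a X p : @vector_field R (pb_total P) X ->
  cn_on theta (translate_field a X) (p *r a) = Ad a^g (cn_on theta X p).
Proof.
move=> vX; rewrite /cn_on translate_field_at.
by rewrite cn_equivariant //; exact: field_tangent vX p.
Qed.

(** Derivations are additive on smooth functions only, hence the condition on the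
    coordinates of [F]. *)
Lemma field_vec_linear (h : {linear g -> g}) X (F : pb_total P -> g) p :
  @vector_field R (pb_total P) X ->
  (forall i, @smooth_fun R (pb_total P) (fun q => coord b i (F q))) ->
  field_vec X (fun q => h (F q)) p = h (field_vec X F p).
Proof.
move=> vX sF; have tX := field_tangent vX p.
have XE i : X (fun q => coord b i (h (F q))) p =
    \sum_(j < \dim {:g}) coord b i (h b`_j) * X (fun q => coord b j (F q)) p.
  have -> : (fun q => coord b i (h (F q))) =
      (fun q => \sum_(j < \dim {:g}) coord b i (h b`_j) * coord b j (F q)).
    apply/funext => q; rewrite {1}(coord_vbasisE (F q)) !linear_sum /=.
    by apply: eq_bigr => j _; rewrite !linearZ /= mulrC.
  have sj (j : 'I_(\dim {:g})) : @smooth_fun R (pb_total P) (fun q => coord b i (h b`_j) * coord b j (F q)).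
    by apply: smooth_funM => //; exact: smooth_fun_cst.
  have [_ XS] := tangent_sum tP tX sj.
  rewrite [LHS]XS; apply: eq_bigr => j _.
  exact: (tangentZ tP tX _ (sF j)).
rewrite /field_vec (coord_vbasisE (h _)); apply: eq_bigr => i _; congr (_ *: _).
rewrite XE !linear_sum; apply: eq_bigr => j _ /=.
by rewrite !linearZ /= mulrC.
Qed.

Lemma field_vec_translate a X (F : pb_total P -> g) p :
  field_vec (translate_field a X) F (p *r a) = field_vec X (fun q => F (q *r a)) p.
Proof.
by rewrite /field_vec; apply: eq_bigr => i _; rewrite /translate_field pb_actK.
Qed.

(** The cross terms in the product rules for [X Y] and [Y X] cancel. *)
Lemma vector_field_bracket X Y : @vector_field R (pb_total P) X ->
  @vector_field R (pb_total P) Y -> @vector_field R (pb_total P) (field_bracket X Y).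
Proof.
move=> vX vY.
have comb Z Z' (p : pb_total P) k f h : @vector_field R (pb_total P) Z ->
    @vector_field R (pb_total P) Z' -> smooth_fun f -> smooth_fun h ->
    Z (Z' (fun x => k * f x + h x)) p = k * Z (Z' f) p + Z (Z' h) p.
  move=> vZ vZ' sf sh.
  have -> : Z' (fun x => k * f x + h x) = (fun q => k * Z' f q + Z' h q).
    by apply/funext => q; apply: (tangent_linear (field_tangent vZ' q)).
  by apply: (tangent_linear (field_tangent vZ p)); apply: field_smooth vZ' _ _.
have leib Z Z' (p : pb_total P) f h : @vector_field R (pb_total P) Z ->
    @vector_field R (pb_total P) Z' -> smooth_fun f -> smooth_fun h ->
    Z (Z' (fun x => f x * h x)) p =
    Z (Z' f) p * h p + Z' f p * Z h p + (Z f p * Z' h p + f p * Z (Z' h) p).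
  move=> vZ vZ' sf sh.
  have -> : Z' (fun x => f x * h x) = (fun q => Z' f q * h q + f q * Z' h q).
    by apply/funext => q; apply: (tangent_leibniz (field_tangent vZ' q)).
  have sZf := field_smooth vZ' sf; have sZh := field_smooth vZ' sh.
  rewrite -[LHS]/(field_at Z p _) (tangentD (field_tangent vZ p)); [|exact: smooth_funM..].
  by congr (_ + _); apply: (tangent_leibniz (field_tangent vZ p)).
split=> [p|f sf].
  split=> [k f h sf sh|f h sf sh]; rewrite /field_at /field_bracket.
    by rewrite (comb X) // (comb Y) //; ring.
  by rewrite (leib X) // (leib Y) //; ring.
have sXY := field_smooth vX (field_smooth vY sf).
have sYX := field_smooth vY (field_smooth vX sf).
rewrite /field_bracket.
have -> : (fun p => X (Y f) p - Y (X f) p) = (fun p => X (Y f) p + (-1) * Y (X f) p).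
  by apply/funext => p; rewrite mulN1r.
by apply: smooth_funD => //; apply: smooth_funM => //; exact: smooth_fun_cst.
Qed.

(** The connection form is equivariant and the exterior derivative commutes
    with diffeomorphisms, so the curvature is equivariant as well. *)
Lemma curvature_translate a X Y p : @vector_field R (pb_total P) X ->
  @vector_field R (pb_total P) Y ->
  curvature theta (translate_field a X) (translate_field a Y) (p *r a) =
  Ad a^g (curvature theta X Y p).
Proof.
move=> vX vY; rewrite /curvature !field_vec_translate translate_field_bracket.
have E Z : @vector_field R (pb_total P) Z ->
    (fun q => cn_on theta (translate_field a Z) (q *r a)) =
    (fun q => Ad a^g (cn_on theta Z q)).
  by move=> vZ; apply/funext => q; exact: cn_on_translate.
rewrite !E // !cn_on_translate //; last exact: vector_field_bracket.
rewrite !(field_vec_linear (Ad a^g)) //; [|exact: cn_smooth..].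
by rewrite -Ad_bracket !linearD !linearN.
Qed.

Lemma horizontal_translate a X p : @vector_field R (pb_total P) X ->
  horizontal theta p (field_at X p) ->
  horizontal theta (p *r a) (field_at (translate_field a X) (p *r a)).
Proof.
move=> vX [_ X0]; split.
  exact: field_tangent (vector_field_translate a vX) _.
by rewrite -/(cn_on _ _ _) cn_on_translate // /cn_on X0 linear0.
Qed.

(** Right translation by [a] pulls [curvature_form u] at [p a] back to
    [curvature_form (Ad a u)] at [p], the inner product being invariant. *)
Lemma fat_elt_Ad a u : compact [set: G] -> fat_elt theta u -> fat_elt theta (Ad a u).
Proof.
move=> cG fu p X vX hX XY.
have vXa := vector_field_translate a vX.
have Xa0 := fu (p *r a) _ vXa (horizontal_translate a vX hX).
have {Xa0} Xa0 : @eq_tangent R (pb_total P) (field_at (translate_field a X) (p *r a)) (fun=> 0).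
  apply: Xa0 => Y vY hY.
  have vYa := vector_field_translate a^g vY.
  rewrite -(translate_fieldK a Y) /curvature_form curvature_translate //.
  rewrite -(inner_Ad cG a) AdKV; apply: XY => //.
  by rewrite -(pb_actK a p); exact: horizontal_translate.
move=> f sf; have := Xa0 _ (smooth_fun_pb_act a^g sf).
rewrite translate_field_at /Defs.pushforward.
by congr (field_at X p _ = 0); apply/funext => q /=; rewrite pb_actK.
Qed.

End Bundle.

Theorem corollary1p4 (R : realType) (G : lie_group R) (g : lie_algebra G)
    (P : principal_bundle G) (theta : connection g P) (C : {vspace g})
    (G_compact : compact [set: G]) (g_semisimple : semisimple g)
    (C_cartan : cartan_sub C) :
  fat_connection theta <-> fat_sub theta (orth_compl C).
Proof.
split=> [fat u _|fat u _ u0]; first exact: fat.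
have [a Ca] := Ad_orbit_meets_orth G_compact g_semisimple u C_cartan.1.
rewrite -(AdK a u); apply: fat_elt_Ad => //; apply: fat => //.
by apply: contra u0 => /eqP Au; rewrite -(AdK a u) Au linear0.
Qed.
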